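(* Fix $\beta>0$. For the partition function $Z_n(\beta,h)$ of the Curie--Weiss model, the following convergence holds vaguely on $\mathbb R$ as $n\to\infty$: $$\frac1n\sum_{y\in\mathbb R:\,Z_n(\beta,iy)=0}\delta_y\longrightarrow\nu_\beta .$$ Here the zeroes are counted with multiplicities, and $\nu_\beta$ is the measure on $\mathbb R$ which is invariant under the shifts $y\mapsto y+\pi\ell$, $\ell\in\mathbb Z$, and is characterized by $\nu_\beta(A)=\mathfrak N_{4\beta}(-e^{2iA})$ for every Borel set $A\subset(-\frac\pi2,\frac\pi2]$, where $-e^{2iA}=\{-e^{2iy}:y\in A\}$ and $\mathfrak N_{4\beta}$ is the free unitary normal distribution on the unit circle with parameter $\sigma^2=4\beta$.
   Context: The partition function of the Curie--Weiss model at inverse temperature $\beta>0$ and external field $h$ (here allowed to be complex) is $$Z_n(\beta,h)=\sum_{(\sigma_1,\ldots,\sigma_n)\in\{\pm1\}^n}e^{\frac{\beta}{2n}\left(\sum_{k=1}^n\sigma_k\right)^2+h\sum_{k=1}^n\sigma_k}.$$ $\mathbb D=\{|z|<1\}$, $\mathbb T=\{|z|=1\}$. For a probability measure $\mu$ on $\mathbb T$, the $\psi$-transform is $\psi_\mu(z)=\int_{\mathbb T}\frac{uz}{1-uz}\mu(du)$, $z\in\mathbb D$. If $\psi_\mu'(0)=\int_{\mathbb T} u\,\mu(du)\neq0$, then $\psi_\mu$ has an analytic inverse $\psi_\mu^{-1}$ near $0$ and the $S$-transform is $S_\mu(z)=\frac{1+z}{z}\psi_\mu^{-1}(z)$. The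 free unitary normal distribution $\mathfrak N_{\sigma^2}$, $\sigma^2>0$, is the (unique) probability measure on $\mathbb T$ with $S_{\mathfrak N_{\sigma^2}}(z)=e^{\sigma^2(z+\frac12)}$ for $z$ near $0$. *)

(* Defs.v *)
From HB Require Import structures.
From mathcomp Require Import all_boot all_order all_algebra.
From mathcomp Require Import all_classical all_reals all_analysis.
From mathcomp Require Import complex.

Set Implicit Arguments.
Unset Strict Implicit.
Unset Printing Implicit Defensive.
Import Order.TTheory GRing.Theory Num.Theory numFieldNormedType.Exports.
Import complex.
Local Open Scope ring_scope.
Local Open Scope complex_scope.
Local Open Scope classical_set_scope.

(* R[i] packed as a numClosedFieldType: the topological and normed structures
   of numFieldNormedType are keyed on the abstract sorts and are not found on
   the bare type R[i]. *)
Definition Cplx (R : realType) : numClosedFieldType := R[i].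

Definition cexp (R : realType) (z : Cplx R) : Cplx R :=
  (expR (Re z) * cos (Im z)) +i* (expR (Re z) * sin (Im z)).

Definition spin (R : realType) (b : bool) : Cplx R := (-1) ^+ b.

Definition Zcw (R : realType) (n : nat) (beta : R) (h : Cplx R) : Cplx R :=
  \sum_(s : {ffun 'I_n -> bool})
    cexp ((beta / (2 * n%:R))%:C * (\sum_(k < n) spin R (s k)) ^+ 2
          + h * (\sum_(k < n) spin R (s k))).

(* The order m is unique when it exists; it exists at every point for an
   entire function that is not identically zero, so the default value 0 of
   multiplicity is not used for such functions. *)
Definition is_order (R : realType) (f : Cplx R -> Cplx R) (z : Cplx R)
    (m : nat) : Prop :=
  (forall k : nat, (k < m)%N -> derive1n k f z = 0) /\ derive1n m f z != 0.

Definition multiplicity (R : realType) (f : Cplx R -> Cplx R) (z : Cplx R) :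
  nat := xget 0%N [set m | is_order f z m].

Definition real_zeros (R : realType) (f : Cplx R -> Cplx R) : set R :=
  [set y | f y%:C = 0].

(* The sum of the Dirac masses delta_y over the real zeros y of f, counted
   with multiplicities. *)
Section zero_measure.
Local Open Scope ereal_scope.
Variables (R : realType) (f : Cplx R -> Cplx R).

Definition zero_measure (A : set (measurableTypeR R)) : \bar R :=
  \esum_(y in A `&` real_zeros f) (multiplicity f y%:C)%:R%:E.

Let zero_measure0 : zero_measure set0 = 0.
Proof. by rewrite /zero_measure set0I esum_set0. Qed.

Let zero_measure_ge0 A : 0 <= zero_measure A.
Proof. by apply: esum_ge0 => y _; rewrite lee_fin. Qed.

Let zero_measure_sigma_additive : semi_sigma_additive zero_measure.
Proof.
move=> F mF tF mUF.
rewrite [X in _ --> X](_ : _ = \sum_(i <oo) zero_measure (F i)).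
  by apply: is_cvg_nneseries => n _ _; exact: zero_measure_ge0.
rewrite /zero_measure setI_bigcupl esum_bigcupT.
- by rewrite nneseries_esumT// => n; exact: zero_measure_ge0.
- exact: trivIset_setIr.
- by move=> y; rewrite lee_fin.
Qed.

HB.instance Definition _ := isMeasure.Build _ _ _ zero_measure
  zero_measure0 zero_measure_ge0 zero_measure_sigma_additive.

End zero_measure.

Definition vague_cvg (R : realType)
    (mu_ : nat -> {measure set (measurableTypeR R) -> \bar R})
    (mu : {measure set (measurableTypeR R) -> \bar R}) : Prop :=
  forall f : R -> R, continuous f -> compact (closure [set x | f x != 0]) ->
    (\int[mu_ n]_x (f x)%:E)%E @[n --> \oo] --> (\int[mu]_x (f x)%:E)%E.

Definition BorelC (R : realType) := g_sigma_algebraType (@open (Cplx R)).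

Definition circle (R : realType) : set (Cplx R) := [set u | `|u| = 1].

Definition cintegral (R : realType) (mu : {measure set (BorelC R) -> \bar R})
    (D : set (Cplx R)) (g : Cplx R -> Cplx R) : Cplx R :=
  Rintegral mu D (fun u => Re (g u)) +i* Rintegral mu D (fun u => Im (g u)).

Definition psi (R : realType) (mu : {measure set (BorelC R) -> \bar R})
    (z : Cplx R) : Cplx R :=
  cintegral mu (@circle R) (fun u => u * z / (1 - u * z)).

Definition is_psi_inverse (R : realType)
    (mu : {measure set (BorelC R) -> \bar R}) (chi : Cplx R -> Cplx R) : Prop :=
  [/\ chi 0 = 0,
      \forall z \near (0 : Cplx R), derivable chi z 1,
      \forall z \near (0 : Cplx R), psi mu (chi z) = z &
      \forall z \near (0 : Cplx R), chi (psi mu z) = z].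

(* S is the S-transform of mu as a germ at 0; the formula defining it does not
   make sense at z = 0, where the value is the one given by continuity. *)
Definition is_S_transform (R : realType)
    (mu : {measure set (BorelC R) -> \bar R}) (S : Cplx R -> Cplx R) : Prop :=
  cintegral mu (@circle R) id != 0 /\
  exists chi : Cplx R -> Cplx R,
    [/\ is_psi_inverse mu chi,
        \forall z \near (0 : Cplx R)^', S z = (1 + z) / z * chi z &
        {for 0, continuous S}].

(* A probability measure on the unit circle is represented as a Borel
   probability measure on the complex plane giving mass 1 to the circle. *)
Definition free_unitary_normal (R : realType) (s2 : R)
    (mu : probability (BorelC R) R) : Prop :=
  mu (@circle R) = 1%E /\
  is_S_transform mu (fun z => cexp (s2%:C * (z + 2^-1))).

Definition is_nu (R : realType) (N : probability (BorelC R) R)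
    (nu : {measure set (measurableTypeR R) -> \bar R}) : Prop :=
  (forall (l : int) (A : set (measurableTypeR R)), measurable A ->
     nu [set y + pi * l%:~R | y in A] = nu A) /\
  (forall A : set (measurableTypeR R), measurable A ->
     A `<=` `](- (pi / 2)), (pi / 2)]%classic ->
     nu A = N [set - cexp (2 * 'i * y%:C) | y in A]).

(* Main.v *)
(* Expanding over the number of positive spins, [Z_n(h)] is a constant times
   [exp(-n h) P_n(exp(2 h))], where
   [P_n(w) = sum_k 'C(n,k) exp(-2 beta k(n-k)/n) w^k].

   Lee-Yang: if all roots of [f] lie on the unit circle, so do those of the
   polynomial with coefficients [cosh((2k-n)s) f_k], because its value at [w] is
   a sum of two terms whose moduli are compared factor by factor. Iterating on
   [(1+X)^n] with [N s^2 = beta/n] and letting [N] tend to infinity gives [P_n].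

   Let [u_j] be minus the roots of [P_n], and
   [psi_n(t) = (1/n) sum_j u_j t/(1 - u_j t)]. The coefficients of [P_n] satisfy
   a q-difference equation with [r = exp(4 beta/n)], whose logarithmic form is
     [psi_n(t) = t exp(-2 beta (n-1)/n) (1 + psi_n(r t)) P_n(-r t)/P_n(-t)],
   so that, up to [O(1/n)], [psi_n(t)] is a fixed point of
     [x |-> t (1 + x) exp(-4 beta (x + 1/2))].
   The S-transform of the free unitary normal law says exactly that [psi(t)] is
   a fixed point, and for small [t > 0] the map is a contraction; hence
   [psi_n(t)] tends to [psi(t)].

   Dividing by powers of [t] and letting [t] tend to 0 gives the convergence of
   all moments, Fejer approximation that of all continuous pi-periodic test
   functions of the argument, and a shift-invariant measure integrates a
   compactly supported function as it integrates its pi-periodization over one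
   period. *)

From HB Require Import structures.
Require Import Defs.
From mathcomp Require Import all_boot all_order all_algebra.
From mathcomp Require Import all_classical all_reals all_analysis.
From mathcomp Require Import measurable_realfun complex ring lra zify.
Import Order.TTheory GRing.Theory Num.Theory numFieldNormedType.Exports.
Import complex.
Local Open Scope ring_scope.
Local Open Scope complex_scope.
Local Open Scope classical_set_scope.
Set Implicit Arguments.
Unset Strict Implicit.
Unset Printing Implicit Defensive.

(** * Modulus and exponential of complex numbers *)

(** The exponential in the S-transform appears as follows. The quotient [P_n(-r t)/P_n(-t)] is a
    product of [n] factors [1 - (r-1) u t/(1 - u t)], and [r - 1] is about [4 beta/n]; each factor
    is nearly the exponential of its increment, so the product is nearly [exp(-4 beta psi_n(t))].
    The prefactor [exp(-2 beta (n-1)/n)] supplies the 1/2 in [x + 1/2]. Lee-Yang has to come before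
    this: with every [u_j] on the circle, [u t/(1 - u t)] has modulus at most [2 t] for [t <= 1/2],
    so all errors are bounded without knowing where the roots lie, and one range of [t] serves every
    large [n]. Only real positive [t] is used, since these values near 0 already yield the moments
    one after another. No compactness of families of measures is needed: the limit is known
    beforehand, and [psi_n] is compared with it directly. *)

Section modulus.
Variable R : realType.
Local Notation C := (Cplx R).
Implicit Types (x y : R) (z w : C).

Lemma cReD z w : Re (z + w) = Re z + Re w. Proof. by case: z; case: w. Qed.
Lemma cImD z w : Im (z + w) = Im z + Im w. Proof. by case: z; case: w. Qed.
Lemma cReN z : Re (- z) = - Re z. Proof. by case: z. Qed.
Lemma cImN z : Im (- z) = - Im z. Proof. by case: z. Qed.
Lemma cReM z w : Re (z * w) = Re z * Re w - Im z * Im w.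
Proof. by case: z; case: w. Qed.
Lemma cImM z w : Im (z * w) = Re z * Im w + Im z * Re w.
Proof. by case: z; case: w. Qed.

Lemma cplx_eq z w : Re z = Re w -> Im z = Im w -> z = w.
Proof. by case: z; case: w => a b c d /= -> ->. Qed.

Lemma Re_sum (I : Type) (s : seq I) (P : pred I) (F : I -> C) :
  Re (\sum_(i <- s | P i) F i) = \sum_(i <- s | P i) Re (F i).
Proof. by apply: (big_morph (@Re R)) => // z w; exact: cReD. Qed.
Lemma Im_sum (I : Type) (s : seq I) (P : pred I) (F : I -> C) :
  Im (\sum_(i <- s | P i) F i) = \sum_(i <- s | P i) Im (F i).
Proof. by apply: (big_morph (@Im R)) => // z w; exact: cImD. Qed.

Lemma rcD x y : (x + y)%:C = x%:C + y%:C :> C.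
Proof. by apply: cplx_eq; rewrite /= ?addr0. Qed.
Lemma rcN x : (- x)%:C = - x%:C :> C.
Proof. by apply: cplx_eq; rewrite /= ?oppr0. Qed.
Lemma rcB x y : (x - y)%:C = x%:C - y%:C :> C.
Proof. by rewrite rcD rcN. Qed.
Lemma rcM x y : (x * y)%:C = x%:C * y%:C :> C.
Proof. by apply: cplx_eq; rewrite /= ?mul0r ?mulr0 ?subr0 ?addr0. Qed.
Lemma rc1 : 1%:C = 1 :> C. Proof. by []. Qed.
Lemma rc0 : 0%:C = 0 :> C. Proof. by []. Qed.
Lemma rcX x n : (x ^+ n)%:C = x%:C ^+ n :> C.
Proof. by elim: n => [|n IH]; rewrite ?expr0// !exprS rcM IH. Qed.
Lemma rc_nat n : (n%:R)%:C = n%:R :> C.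
Proof. by elim: n => [|n IH]; rewrite ?rc0// -!natr1 rcD IH. Qed.
Lemma rcMn x n : (x *+ n)%:C = x%:C *+ n :> C.
Proof. by elim: n => [|n IH]; rewrite ?mulr0n// !mulrS rcD IH. Qed.
Lemma rc_inj x y : x%:C = y%:C :> C -> x = y.
Proof. by move=> /(congr1 (@Re R)). Qed.
Lemma rcV x : (x^-1)%:C = (x%:C)^-1 :> C.
Proof.
have [->|x0] := eqVneq x 0; first by rewrite invr0 rc0 invr0.
have x0' : x%:C != 0 :> C by apply: contra_neq x0 => /rc_inj.
by apply: (mulfI x0'); rewrite -rcM !mulfV.
Qed.
Lemma rc_sum (I : Type) (s : seq I) (P : pred I) (F : I -> R) :
  (\sum_(i <- s | P i) F i)%:C = \sum_(i <- s | P i) (F i)%:C :> C.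
Proof. by apply: (big_morph (fun x => x%:C : C)) => // z w; exact: rcD. Qed.

(** The norm of [Cplx R] takes its values in [Cplx R] itself; a real-valued modulus gives access to
    real order reasoning. *)
Definition cmod z : R := Num.sqrt (Re z ^+ 2 + Im z ^+ 2).

Lemma norm_cmod z : `|z| = (cmod z)%:C. Proof. by case: z. Qed.

Lemma cmod_ge0 z : 0 <= cmod z. Proof. exact: sqrtr_ge0. Qed.

Lemma cmod_sq z : cmod z ^+ 2 = Re z ^+ 2 + Im z ^+ 2.
Proof. by rewrite sqr_sqrtr// addr_ge0// sqr_ge0. Qed.

Lemma cmodM z w : cmod (z * w) = cmod z * cmod w.
Proof. by apply: rc_inj; rewrite rcM -!norm_cmod normrM. Qed.

Lemma le_cmodD z w : cmod (z + w) <= cmod z + cmod w.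
Proof. by have := ler_normD z w; rewrite !norm_cmod -rcD lecR. Qed.

Lemma cmodN z : cmod (- z) = cmod z.
Proof. by rewrite /cmod cReN cImN !sqrrN. Qed.

Lemma cmodC z w : cmod (z - w) = cmod (w - z).
Proof. by rewrite -cmodN opprB. Qed.

Lemma cmod0 : cmod 0 = 0.
Proof. by rewrite /cmod/= expr0n addr0 sqrtr0. Qed.

Lemma cmod_rc x : cmod x%:C = `|x|.
Proof. by rewrite /cmod/= expr0n addr0 sqrtr_sqr. Qed.

Lemma cmod1 : cmod 1 = 1.
Proof. by rewrite -rc1 cmod_rc normr1. Qed.

Lemma cmod_eq0 z : (cmod z == 0) = (z == 0).
Proof.
apply/eqP/eqP => [h|->]; last exact: cmod0.
by apply/eqP; rewrite -normr_eq0 norm_cmod h.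
Qed.

Lemma cmod_gt0 z : (0 < cmod z) = (z != 0).
Proof. by rewrite lt_neqAle cmod_ge0 andbT eq_sym cmod_eq0. Qed.

Lemma cmodV z : cmod z^-1 = (cmod z)^-1.
Proof. by apply: rc_inj; rewrite rcV -!norm_cmod normfV. Qed.

Lemma cmodX z n : cmod (z ^+ n) = cmod z ^+ n.
Proof. by elim: n => [|n IH]; rewrite ?expr0 ?cmod1// !exprS cmodM IH. Qed.

Lemma cmod_prod (I : Type) (s : seq I) (P : pred I) (F : I -> C) :
  cmod (\prod_(i <- s | P i) F i) = \prod_(i <- s | P i) cmod (F i).
Proof. by apply: big_morph; [exact: cmodM | exact: cmod1]. Qed.

Lemma le_cmod_sum (I : Type) (s : seq I) (P : pred I) (F : I -> C) :
  cmod (\sum_(i <- s | P i) F i) <= \sum_(i <- s | P i) cmod (F i).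
Proof.
elim/big_rec2 : _ => [|i y z _ h]; first by rewrite cmod0.
by apply: le_trans (le_cmodD _ _) _; rewrite lerD2l.
Qed.

Lemma le_cmodB z w : cmod (z - w) <= cmod z + cmod w.
Proof. by rewrite -(cmodN w) le_cmodD. Qed.

Lemma le_cmod_dist z w : cmod z - cmod w <= cmod (z - w).
Proof. by rewrite lerBlDr; apply: le_trans _ (le_cmodD _ _); rewrite subrK. Qed.

Lemma Re_le_cmod z : `|Re z| <= cmod z.
Proof. by rewrite -sqrtr_sqr ler_wsqrtr// lerDl sqr_ge0. Qed.

Lemma Im_le_cmod z : `|Im z| <= cmod z.
Proof. by rewrite -sqrtr_sqr ler_wsqrtr// lerDr sqr_ge0. Qed.

Lemma cmod_le_ReIm z : cmod z <= `|Re z| + `|Im z|.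
Proof.
have -> : z = (Re z)%:C + 'i * (Im z)%:C.
  by apply: cplx_eq; rewrite /= ; ring.
apply: le_trans (le_cmodD _ _) _; rewrite cmodM !cmod_rc.
have -> : cmod 'i = 1 by rewrite /cmod /= expr0n expr1n add0r sqrtr1.
by rewrite /= !(mul0r,mulr0,mul1r,subr0,addr0,add0r).
Qed.

End modulus.

Section complex_exponential.
Variable R : realType.
Local Notation C := (Cplx R).
Implicit Types (x y : R) (z w : C).

Lemma cexp0 : cexp (0 : C) = 1.
Proof. by apply: cplx_eq; rewrite /= expR0 ?cos0 ?sin0 mul1r. Qed.

Lemma cexpD z w : cexp (z + w) = cexp z * cexp w.
Proof.
apply: cplx_eq; rewrite ?cReM ?cImM /= cReD cImD expRD ?cosD ?sinD; ring.
Qed.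

Lemma cmod_cexp z : cmod (cexp z) = expR (Re z).
Proof.
rewrite /cmod/= !exprMn -mulrDr cos2Dsin2 mulr1 sqrtr_sqr ger0_norm//.
Qed.

Lemma cexp_neq0 z : cexp z != 0.
Proof. by rewrite -cmod_gt0 cmod_cexp expR_gt0. Qed.

Lemma cexpN z : cexp (- z) = (cexp z)^-1.
Proof.
by apply: (mulfI (cexp_neq0 z)); rewrite -cexpD subrr cexp0 mulfV// cexp_neq0.
Qed.

Lemma cexp_rc x : cexp (x%:C : C) = (expR x)%:C.
Proof. by apply: cplx_eq; rewrite /= ?cos0 ?sin0 ?mulr1 ?mulr0. Qed.

Lemma cexp_sum (I : Type) (s : seq I) (P : pred I) (F : I -> C) :
  cexp (\sum_(i <- s | P i) F i) = \prod_(i <- s | P i) cexp (F i).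
Proof. by apply: big_morph; [exact: cexpD | exact: cexp0]. Qed.

Lemma cexpMn z n : cexp (n%:R * z) = cexp z ^+ n.
Proof.
elim: n => [|n IH]; first by rewrite mul0r cexp0.
by rewrite -natr1 mulrDl cexpD mul1r IH exprSr.
Qed.

Lemma norm_sin_le x : `|sin x| <= `|x|.
Proof.
have H : forall y, 0 < y -> `|sin y| <= `|y|.
  move=> y y0.
  have [c cy] : exists2 c, c \in `]0, y[%R & sin y - sin 0 = cos c * (y - 0).
    apply: MVT => //.
    by apply: continuous_subspaceT; exact: continuous_sin.
  rewrite sin0 !subr0 => ->; rewrite normrM ler_piMl//.
  exact: cos_max.
have [x0|x0|<-] := ltgtP 0 x; [exact: H| |by rewrite sin0].
by rewrite -(normrN x) -(normrN (sin x)) -sinN H// oppr_gt0.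
Qed.

Lemma cos_ge_quad x : 1 - x ^+ 2 / 2 <= cos x.
Proof.
rewrite [in cos x](_ : x = (x / 2) *+ 2); last by rewrite -mulr_natr divfK.
rewrite cos_mulr2n cos2sin2.
have := norm_sin_le (x / 2).
rewrite -(@ler_pXn2r _ 2)// ?nnegrE// !real_normK ?num_real//.
rewrite (_ : (x / 2) ^+ 2 = x ^+ 2 / 4); last by field.
by move: (sin _ ^+ 2) (x ^+ 2) => a b h; lra.
Qed.

Lemma norm_sin_sub_le x : `|sin x - x| <= `|x| ^+ 3.
Proof.
have H : forall y, 0 < y -> `|sin y - y| <= `|y| ^+ 3.
  move=> y y0.
  have [c cy] : exists2 c, c \in `]0, y[%R &
      (sin y - y) - (sin 0 - 0) = (cos c - 1) * (y - 0).
    apply: (@MVT _ (fun y => sin y - y) (fun y => cos y - 1)) => //.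
    apply: continuous_subspaceT => t; apply: cvgB; last exact: cvg_id.
    exact: continuous_sin.
  rewrite sin0 !subr0 => ->; rewrite normrM exprSr.
  apply: ler_wpM2r => //.
  have := cos_ge_quad c; have := cos_le1 c.
  move: cy; rewrite in_itv/= => /andP[c0 cy].
  have : c ^+ 2 <= y ^+ 2 by rewrite ler_pXn2r// ?nnegrE ltW.
  rewrite (gtr0_norm y0) ler0_norm; last by rewrite subr_le0 cos_le1.
  move: (cos c) (c ^+ 2) (y ^+ 2) (sqr_ge0 c : 0 <= c ^+ 2) => a b d *; lra.
have [x0|x0|<-] := ltgtP 0 x; [exact: H| |by rewrite sin0 subr0 normr0 expr0n].
have := H (- x); rewrite oppr_gt0 sinN -opprD !normrN; exact.
Qed.

Lemma expR_le_inv x : x < 1 -> expR x <= (1 - x)^-1.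
Proof.
move=> x1; rewrite -[expR x]invrK -expRN lef_pV2 ?posrE ?expR_gt0 ?subr_gt0//.
by rewrite expR_ge1Dx.
Qed.

Lemma expR_sub1_le x : `|x| <= 1 / 2 -> `|expR x - 1 - x| <= 2 * x ^+ 2.
Proof.
move=> hx; have /andP[x1 x2] : - (1 / 2) <= x <= 1 / 2 by rewrite -ler_norml.
have h1 := expR_ge1Dx x.
rewrite ger0_norm; last by lra.
have h2 : expR x <= (1 - x)^-1 by apply: expR_le_inv; lra.
suff : (1 - x)^-1 <= 1 + x + 2 * x ^+ 2 by lra.
rewrite -[X in X <= _]mul1r ler_pdivrMr; nra.
Qed.

(** For [z = a + i b] the real part is split as [(e^a - 1 - a) + e^a (cos b - 1)] and the imaginary
    part as [(e^a - 1) sin b + (sin b - b)]. Each part is at most [3 |z|^2]. *)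
Lemma cexp_sub1_quad z : cmod z <= 1 / 2 ->
  cmod (cexp z - 1 - z) <= 6 * cmod z ^+ 2.
Proof.
move=> hz; set a := Re z; set b := Im z; set r := cmod z in hz *.
have ar : `|a| <= r by exact: Re_le_cmod.
have br : `|b| <= r by exact: Im_le_cmod.
have r0 : 0 <= r by exact: cmod_ge0.
have ha : `|expR a - 1 - a| <= 2 * a ^+ 2.
  by apply: expR_sub1_le; exact: le_trans ar hz.
have a2 : a ^+ 2 <= r ^+ 2 by rewrite -real_normK ?num_real// ler_pXn2r// nnegrE.
have b2 : b ^+ 2 <= r ^+ 2 by rewrite -real_normK ?num_real// ler_pXn2r// nnegrE.
have b3 : `|sin b - b| <= r ^+ 2.
  apply: le_trans (norm_sin_sub_le _) _.
  rewrite exprS; apply: (@le_trans _ _ (1 * `|b| ^+ 2)).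
    by rewrite ler_wpM2r ?sqr_ge0//; lra.
  by rewrite mul1r real_normK ?num_real.
have e2 : expR a <= 2.
  have : expR a <= (1 - a)^-1.
    by apply: expR_le_inv; move: (ler_norm a); lra.
  move=> /le_trans; apply; rewrite -[X in X <= _]mul1r ler_pdivrMr.
    move: (ler_norm a); lra.
  move: (ler_norm a); lra.
have e0 := expR_ge0 a.
have cb : `|cos b - 1| <= r ^+ 2 / 2.
  rewrite ler0_norm; last by rewrite subr_le0 cos_le1.
  by have := cos_ge_quad b; lra.
have e1 : `|expR a - 1| <= 2 * r.
  rewrite (_ : expR a - 1 = (expR a - 1 - a) + a); last by ring.
  apply: le_trans (ler_normD _ _) _.
  nra.
have sb : `|sin b| <= r by exact: le_trans (norm_sin_le b) br.
apply: le_trans (cmod_le_ReIm _) _.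
rewrite !cReD !cImD !cReN !cImN /= -/a -/b oppr0 addr0.
have -> : expR a * cos b - 1 - a = (expR a - 1 - a) + expR a * (cos b - 1) by ring.
have -> : expR a * sin b - b = (expR a - 1) * sin b + (sin b - b) by ring.
have h1 : `|expR a * (cos b - 1)| <= 2 * (r ^+ 2 / 2).
  by rewrite normrM ger0_norm//; apply: ler_pM.
have h2 : `|(expR a - 1) * sin b| <= 2 * r * r.
  by rewrite normrM; apply: ler_pM.
have := ler_normD (expR a - 1 - a) (expR a * (cos b - 1)).
have := ler_normD ((expR a - 1) * sin b) (sin b - b).
move: h1 h2 ha; rewrite (_ : 2 * r * r = 2 * r ^+ 2); last by ring.
lra.
Qed.

Lemma cexp_sub1_le z : cmod z <= 1 / 2 -> cmod (cexp z - 1) <= 4 * cmod z.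
Proof.
move=> hz; rewrite (_ : cexp z - 1 = (cexp z - 1 - z) + z); last by ring.
apply: le_trans (le_cmodD _ _) _.
have := cexp_sub1_quad hz; have := cmod_ge0 z; nra.
Qed.

End complex_exponential.

Lemma cvg_sumR (R : realType) (I : Type) (r : seq I) (P : pred I)
    (f : I -> nat -> R) (l : I -> R) :
  (forall i, P i -> f i m @[m --> \oo] --> l i) ->
  \sum_(i <- r | P i) f i m @[m --> \oo] --> \sum_(i <- r | P i) l i.
Proof.
move=> fl; elim: r => [|i r IH].
  rewrite big_nil (_ : (fun m => _) = fun=> 0) ?funeqE; first exact: cvg_cst.
  by move=> m; rewrite big_nil.
rewrite big_cons (_ : (fun m => _) = fun m => if P i then
  f i m + \sum_(i <- r | P i) f i m else \sum_(i <- r | P i) f i m).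
  case: ifP => // Pi; apply: cvgD => //; exact: fl.
by apply/funext => m; rewrite big_cons.
Qed.

(** * The Lee-Yang theorem *)

Section cosh_limit.
Variable R : realType.
Implicit Types x y a : R.

Definition cosh x : R := (expR x + expR (- x)) / 2.

Lemma cosh_ge1 x : 1 <= cosh x.
Proof.
rewrite /cosh; have := expR_ge1Dx x; have := expR_ge1Dx (- x).
move: (expR x) (expR (- x)) => *; lra.
Qed.

Lemma coshN x : cosh (- x) = cosh x.
Proof. by rewrite /cosh opprK addrC. Qed.

Lemma cosh_norm x : cosh `|x| = cosh x.
Proof. by case: ger0P => // _; rewrite coshN. Qed.

Lemma cosh_half x : cosh x = 1 + (expR (x / 2) - expR (- (x / 2))) ^+ 2 / 2.
Proof.
rewrite /cosh [in expR x](_ : x = x / 2 + x / 2); last by field.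
rewrite [in expR (- x)](_ : - x = - (x / 2) + - (x / 2)); last by field.
have h : expR (x / 2) * expR (- (x / 2)) = 1 by rewrite -expRD ?subrr ?addNr expR0.
rewrite !expRD.
move: (expR _) (expR _) h => p q h.
have -> : (q - p) ^+ 2 = q * q + p * p - 2 * (q * p) by ring.
by rewrite h; field.
Qed.

Lemma sinh_bounds y : 0 <= y ->
  2 * y * expR (- y) <= expR y - expR (- y) <= 2 * y * expR y.
Proof.
move=> y0.
have e1 := expR_ge1Dx (2 * y); have e2 := expR_ge1Dx (- (2 * y)).
have -> : expR y - expR (- y) = expR (- y) * (expR (2 * y) - 1).
  by rewrite mulrBr mulr1 -expRD; congr (expR _ - _); ring.
apply/andP; split.
  by rewrite mulrC ler_wpM2l ?expR_ge0//; move: e1; move: (expR (2 * y)) => *; lra.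
have -> : expR (- y) * (expR (2 * y) - 1) = expR y * (1 - expR (- (2 * y))).
  by rewrite !mulrBr !mulr1 -!expRD; congr (expR _ - expR _); ring.
rewrite [leRHS]mulrC ler_wpM2l ?expR_ge0//.
move: e2; move: (expR (- (2 * y))) => *; lra.
Qed.

(** Here [cosh x - 1 <= x^2/2 e^|x|] and [1 + v <= e^v]. Bounds of exponential form are wanted
    because they can be raised to a power of order [1/x^2]. *)
Lemma cosh_upper x : cosh x <= expR (x ^+ 2 / 2 * expR `|x|).
Proof.
rewrite -(cosh_norm x) -(real_normK (num_real x)).
have : 0 <= `|x| by []; move: `|x| => {}x x0.
apply: le_trans _ (expR_ge1Dx _).
rewrite cosh_half lerD2l.
have /andP[h1 h2] : _ := sinh_bounds (divr_ge0 x0 (ler0n R 2)).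
have {}h1 : 0 <= expR (x / 2) - expR (- (x / 2)).
  by apply: le_trans _ h1; rewrite mulr_ge0 ?expR_ge0//; lra.
rewrite [in expR x](_ : x = x / 2 + x / 2); last by field.
rewrite expRD.
rewrite (_ : x ^+ 2 / 2 * _ = (2 * (x / 2) * expR (x / 2)) ^+ 2 / 2); last by field.
by rewrite ler_wpM2r// ler_pXn2r// nnegrE// (le_trans h1).
Qed.

(** With [t = x^2/2 e^-|x|] one has [cosh x >= 1 + t >= exp(t/(1+t))], and [1/(1+t)] is at least
    [exp(-x^2/2)] because [t <= x^2/2]. *)
Lemma cosh_lower x : expR (x ^+ 2 / 2 * expR (- `|x| - x ^+ 2 / 2)) <= cosh x.
Proof.
rewrite -(cosh_norm x) -(real_normK (num_real x)).
have : 0 <= `|x| by []; move: `|x| => {}x x0.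
set t := x ^+ 2 / 2 * expR (- x).
have t0 : 0 <= t by rewrite /t mulr_ge0 ?expR_ge0// divr_ge0// sqr_ge0.
have tx : t <= x ^+ 2 / 2.
  by rewrite /t ler_piMr ?divr_ge0 ?sqr_ge0// expR_le1 oppr_le0.
have h1 : expR (x ^+ 2 / 2 * expR (- x - x ^+ 2 / 2)) <= 1 + t.
  rewrite expRD mulrA -/t -[leRHS]invrK.
  rewrite -[X in X <= _]invrK lef_pV2 ?posrE ?invr_gt0 ?expR_gt0//; last by lra.
  rewrite -expRN; apply: le_trans _ (expR_ge1Dx _).
  have : expR (- (x ^+ 2 / 2)) <= (1 + t)^-1.
    rewrite expRN lef_pV2 ?posrE ?expR_gt0//; last by lra.
    by apply: le_trans _ (expR_ge1Dx _); rewrite lerD2l.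
  rewrite -lerN2 => h.
  have : (1 + t)^-1 = 1 - t * (1 + t)^-1 by field; lra.
  move=> ->; rewrite lerD2l lerN2 ler_wpM2l//.
  by rewrite -lerN2.
apply: le_trans h1 _.
rewrite cosh_half lerD2l.
have /andP[h1 h2] : _ := sinh_bounds (divr_ge0 x0 (ler0n R 2)).
rewrite /t [in expR (- x)](_ : - x = - (x / 2) + - (x / 2)); last by field.
rewrite expRD.
rewrite (_ : x ^+ 2 / 2 * _ = (2 * (x / 2) * expR (- (x / 2))) ^+ 2 / 2); last by field.
have h3 : 0 <= 2 * (x / 2) * expR (- (x / 2)).
  by rewrite mulr_ge0 ?expR_ge0//; lra.
by rewrite ler_wpM2r// ler_pXn2r// nnegrE// (le_trans h3).
Qed.

Lemma cvg_cosh_pow a :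
  cosh (a * m.+1%:R^-1) ^+ (m.+1 ^ 2)%N @[m --> \oo] --> expR (a ^+ 2 / 2).
Proof.
have xE m : ((m.+1 ^ 2)%N)%:R * ((a * m.+1%:R^-1) ^+ 2 / 2) = a ^+ 2 / 2 :> R.
  by rewrite natrX; field; rewrite nat1r.
have c0 : a * m.+1%:R^-1 @[m --> \oo] --> (0 : R).
  rewrite -[X in _ --> X](mulr0 a); apply: cvgM; first exact: cvg_cst.
  exact: cvg_harmonic.
have n0 : `|a * m.+1%:R^-1| @[m --> \oo] --> (0 : R).
  by rewrite -[X in _ --> X](normr0 R); exact: cvg_norm.
have s0 : (a * m.+1%:R^-1) ^+ 2 / 2 @[m --> \oo] --> (0 : R).
  rewrite [X in _ --> X](_ : 0 = 0 * 0 / 2); last by rewrite !mul0r.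
  by apply: cvgM; [exact: cvgM | exact: cvg_cst].
pose lo m := expR (a ^+ 2 / 2 * expR (- `|a * m.+1%:R^-1| - (a * m.+1%:R^-1) ^+ 2 / 2)).
pose hi m := expR (a ^+ 2 / 2 * expR `|a * m.+1%:R^-1|).
apply: (@squeeze_cvgr _ _ _ _ lo hi).
- near=> m; apply/andP; split.
    rewrite /lo -(xE m) -mulrA expRM_natl.
    by rewrite lerXn2r ?nnegrE ?expR_ge0 ?(le_trans ler01 (cosh_ge1 _))// cosh_lower.
  rewrite /hi -(xE m) -mulrA expRM_natl.
  by rewrite lerXn2r ?nnegrE ?expR_ge0 ?(le_trans ler01 (cosh_ge1 _))// cosh_upper.
- apply: continuous_cvg; first exact: continuous_expR.
  rewrite -[X in _ --> X]mulr1; apply: cvgM; first exact: cvg_cst.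
  rewrite [X in _ --> X](_ : 1 = expR (- 0 - 0)); last by rewrite oppr0 addr0 expR0.
  apply: continuous_cvg; first exact: continuous_expR.
  by apply: cvgB; [apply: cvgN; exact: n0 | exact: s0].
- apply: continuous_cvg; first exact: continuous_expR.
  rewrite -[X in _ --> X]mulr1; apply: cvgM; first exact: cvg_cst.
  rewrite [X in _ --> X](_ : 1 = expR 0); last by rewrite expR0.
  by apply: continuous_cvg; first exact: continuous_expR.
Unshelve. all: by end_near. Qed.

End cosh_limit.

Section lee_yang.
Variable R : realType.
Local Notation C := (Cplx R).
Implicit Types (f : {poly C}) (n : nat) (s : R).

Definition roots_on_circle f := forall w, root f w -> cmod w = 1.

Lemma poly_factor f : f != 0 -> exists v : seq C,
  [/\ f = lead_coef f *: \prod_(z <- v) ('X - z%:P), size v = (size f).-1 &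
      roots_on_circle f -> {in v, forall z, cmod z = 1}].
Proof.
move=> f0; have [v fE] := closed_field_poly_normal f; exists v; split => //.
  rewrite fE size_scale ?lead_coef_eq0// size_prod_XsubC//.
move=> hf z zv; apply: hf; rewrite fE rootZ ?lead_coef_eq0//.
by rewrite root_prod_XsubC.
Qed.

Lemma cmod_sub_sq (a b : R) (w v : C) : cmod v = 1 ->
  cmod (a%:C * w - b%:C * v) ^+ 2 =
  a ^+ 2 * cmod w ^+ 2 + b ^+ 2 - 2 * a * b * (Re w * Re v + Im w * Im v).
Proof.
move=> v1; have := cmod_sq v; rewrite v1 expr1n => v2.
rewrite (_ : b ^+ 2 = b ^+ 2 * (Re v ^+ 2 + Im v ^+ 2)); last by rewrite -v2 mulr1.
rewrite !cmod_sq !cReD !cImD !cReN !cImN !cReM !cImM /=; ring.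
Qed.

(* The difference of the two squared moduli is
   [(exp(2s) - exp(-2s)) (1 - |w|^2)]. *)
Lemma cmod_swap_lt s (w v : C) : 0 < s -> cmod v = 1 -> cmod w < 1 ->
  cmod ((expR s)%:C * w - (expR (- s))%:C * v) <
  cmod ((expR (- s))%:C * w - (expR s)%:C * v).
Proof.
move=> s0 v1 w1.
rewrite -(@ltr_pXn2r _ 2)// ?nnegrE ?cmod_ge0// !cmod_sub_sq//.
have e1 : expR (- s) < expR s by rewrite ltr_expR; lra.
have e2 : expR (- s) ^+ 2 < expR s ^+ 2 by rewrite ltr_pXn2r ?nnegrE ?expR_ge0.
have : cmod w ^+ 2 < 1 by rewrite expr_lt1// cmod_ge0.
move: (Re w * Re v + Im w * Im v) (cmod w ^+ 2) => p q.
move: (expR s) (expR (- s)) e2 => x y; nra.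
Qed.

Lemma cmod_swap_gt s (w v : C) : 0 < s -> cmod v = 1 -> 1 < cmod w ->
  cmod ((expR (- s))%:C * w - (expR s)%:C * v) <
  cmod ((expR s)%:C * w - (expR (- s))%:C * v).
Proof.
move=> s0 v1 w1.
rewrite -(@ltr_pXn2r _ 2)// ?nnegrE ?cmod_ge0// !cmod_sub_sq//.
have e1 : expR (- s) < expR s by rewrite ltr_expR; lra.
have e2 : expR (- s) ^+ 2 < expR s ^+ 2 by rewrite ltr_pXn2r ?nnegrE ?expR_ge0.
have : 1 < cmod w ^+ 2 by rewrite expr_gt1// cmod_ge0.
move: (Re w * Re v + Im w * Im v) (cmod w ^+ 2) => p q.
move: (expR s) (expR (- s)) e2 => x y; nra.
Qed.

Definition cosh_mult n s f : {poly C} :=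
  \poly_(k < n.+1) ((cosh ((k%:R *+ 2 - n%:R) * s))%:C * f`_k).

Lemma horner_cosh_mult n s f w : size f = n.+1 ->
  (cosh_mult n s f).[w] = ((expR (- s))%:C ^+ n * f.[(expR s)%:C ^+ 2 * w] +
     (expR s)%:C ^+ n * f.[(expR (- s))%:C ^+ 2 * w]) / 2.
Proof.
move=> fn; rewrite horner_poly !horner_coef fn.
rewrite !mulr_sumr -big_split/= mulr_suml; apply: eq_bigr => k _.
rewrite ![(_ * w) ^+ k]exprMn.
have -> : (cosh ((k%:R *+ 2 - n%:R) * s))%:C =
  ((expR (- s))%:C ^+ n * ((expR s)%:C ^+ 2) ^+ k +
   (expR s)%:C ^+ n * ((expR (- s))%:C ^+ 2) ^+ k) / 2 :> C.
  rewrite /cosh rcM rcV rc_nat rcD; congr ((_ + _) / _).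
    rewrite -!rcX -rcM -!expRM_natl -expRD -[k%:R *+ 2]mulr_natr.
    by congr ((expR _)%:C); ring.
  rewrite -!rcX -rcM -!expRM_natl -expRD -[k%:R *+ 2]mulr_natr.
  by congr ((expR _)%:C); ring.
move: (_ ^+ n) (_ ^+ n) (_ ^+ k) (_ ^+ k) (_ ^+ k) => a b c d e; ring.
Qed.

Lemma size_cosh_mult n s f : size f = n.+1 -> size (cosh_mult n s f) = n.+1.
Proof.
move=> fn; rewrite size_poly_eq// mulf_neq0//.
  rewrite -cmod_gt0 cmod_rc normr_gt0 gt_eqF// (lt_le_trans ltr01)//.
  exact: cosh_ge1.
by rewrite -[n]/(n.+1.-1) -fn -lead_coefE lead_coef_eq0 -size_poly_gt0 fn.
Qed.

Lemma roots_cosh_mult n s f : 0 < s -> size f = n.+1 ->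
  roots_on_circle f -> roots_on_circle (cosh_mult n s f).
Proof.
move=> s0 fn hf w rw.
have szM := size_cosh_mult s fn.
(* A polynomial with a root is not constant. A nonempty set of factors is what makes the comparison
   of products below strict. *)
have n0 : (0 < n)%N.
  rewrite -ltnS -szM; apply: (@root_size_gt1 _ w) => //.
  by rewrite -size_poly_gt0 szM.
move: rw; rewrite rootE horner_cosh_mult// mulf_eq0 invr_eq0.
rewrite pnatr_eq0 orbF addr_eq0 => /eqP/(congr1 (@cmod R)).
rewrite cmodN.
have f0 : f != 0 by rewrite -size_poly_gt0 fn.
have [v [fE sv hv]] := poly_factor f0.
have {}hv := hv hf.
(* One factor [y] of [y^n] goes to each root: as [x y = 1], [y (x^2 w - z) = x w - y z]. *)
have H (x y : R) : x * y = 1 ->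
   cmod (y%:C ^+ n * f.[x%:C ^+ 2 * w]) =
   cmod (lead_coef f) * \prod_(z <- v) cmod (x%:C * w - y%:C * z).
  move=> xy; rewrite [in f.[_]]fE hornerZ mulrCA cmodM; congr (_ * _).
  rewrite -cmod_prod; congr cmod.
  have -> : n = size v by rewrite sv fn.
  elim: (v) => [|z u IH]; first by rewrite !big_nil expr0 hornerC mul1r.
  rewrite !big_cons hornerM !hornerE -IH /= exprS.
  have -> : x%:C * w - y%:C * z = y%:C * (x%:C ^+ 2 * w - z) :> C.
    rewrite mulrBr mulrA expr2 mulrA -!rcM; congr (_%:C * _ - _).
    by rewrite (mulrC y) xy mul1r.
  ring.
rewrite !H; last 2 first.
- by rewrite -expRD ?subrr ?addNr expR0.
- by rewrite -expRD ?subrr ?addNr expR0.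
have lc : cmod (lead_coef f) != 0 by rewrite cmod_eq0 lead_coef_eq0.
move=> /(mulfI lc).
have hasv : has xpredT v by rewrite has_predT sv fn.
have [w1|w1|//] := ltgtP (cmod w) 1 => E; exfalso; move: E; apply/eqP.
- rewrite lt_eqF// big_seq [ltRHS]big_seq; apply: ltr_prod.
    by rewrite (eq_has (a2 := mem v))// ?has_mem; case: (v) hasv => //= z u _; rewrite in_cons eqxx.
  by move=> z zv; rewrite cmod_ge0/= cmod_swap_lt// hv.
- rewrite gt_eqF// big_seq [ltRHS]big_seq; apply: ltr_prod.
    by case: (v) hasv => //= z u _; rewrite in_cons eqxx.
  by move=> z zv; rewrite cmod_ge0/= cmod_swap_gt// hv.
Qed.

Definition cwcoef n (beta : R) (k : nat) : R :=
  'C(n, k)%:R * expR (- (2 * beta / n%:R * (k * (n - k))%:R)).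

Definition cwpoly n beta : {poly C} := \poly_(k < n.+1) (cwcoef n beta k)%:C.

Definition binpoly n : {poly C} := ('X + 1) ^+ n.

Lemma size_binpoly n : size (binpoly n) = n.+1.
Proof.
rewrite /binpoly (_ : 'X + 1 = 'X - (-1)%:P); last by rewrite polyCN opprK.
exact: size_exp_XsubC.
Qed.

Lemma coef_binpoly n k : (binpoly n)`_k = 'C(n, k)%:R.
Proof.
rewrite /binpoly exprDn coef_sum.
case: (leqP k n) => kn; last first.
  rewrite bin_small// big1// => i _.
  rewrite expr1n mulr1 coefMn coefXn gtn_eqF ?mul0rn//.
  by rewrite (leq_ltn_trans _ kn)// leq_subr.
have kn' : (n - k < n.+1)%N by rewrite ltnS leq_subr.
rewrite (bigD1 (Ordinal kn'))//= expr1n mulr1 coefMn coefXn subKn// eqxx.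
rewrite big1 ?addr0 ?bin_sub// => i ik.
rewrite expr1n mulr1 coefMn coefXn (_ : (k == n - i)%N = false) ?mul0rn//.
apply/negP => /eqP kE; case/eqP: ik; apply/val_inj => /=.
by rewrite kE subKn// -ltnS.
Qed.

(* For [s = sqrt(beta/n)/m] and [N = m^2] this tends, as [m] tends to infinity,
   to a constant multiple of [cwpoly n beta]. *)
Definition lypoly n s N : {poly C} := iter N (cosh_mult n s) (binpoly n).

Lemma size_lypoly n s N : size (lypoly n s N) = n.+1.
Proof.
by elim: N => [|N IH]; rewrite /lypoly ?size_binpoly//= size_cosh_mult.
Qed.

Lemma coef_lypoly n s N k :
  (lypoly n s N)`_k =
  ('C(n, k)%:R * cosh ((k%:R *+ 2 - n%:R) * s) ^+ N)%:C.
Proof.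
elim: N => [|N IH]; first by rewrite coef_binpoly expr0 mulr1 rc_nat.
rewrite /= coef_poly; case: ltnP => kn; first by rewrite IH -rcM exprS mulrCA.
by rewrite bin_small// mul0r.
Qed.

Lemma roots_lypoly n s N : 0 < s -> roots_on_circle (lypoly n s N).
Proof.
move=> s0; elim: N => [|N IH] /=.
  move=> w; rewrite /binpoly /root horner_exp !hornerE expf_eq0 => /andP[_].
  by rewrite addr_eq0 => /eqP ->; rewrite cmodN cmod1.
by apply: roots_cosh_mult => //; exact: size_lypoly.
Qed.

(** A factor [w - z] with [z] on the circle is at least as large as the distance of [w] to the
    circle, and the leading coefficient [cosh(n s)^N] is at least 1. Being independent of [s] and
    [N], the bound takes the place of Hurwitz' theorem in the limit. *)
Lemma lypoly_lower n s N w : 0 < s ->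
  `|cmod w - 1| ^+ n <= cmod (lypoly n s N).[w].
Proof.
move=> s0; have szl := size_lypoly n s N.
have f0 : lypoly n s N != 0 by rewrite -size_poly_gt0 szl.
have [v [fE sv hv]] := poly_factor f0.
have {}hv := hv (@roots_lypoly n s N s0).
rewrite fE hornerZ cmodM.
have h1 : 1 <= cmod (lead_coef (lypoly n s N)).
  rewrite lead_coefE szl coef_lypoly binn mul1r cmod_rc ger0_norm.
    by rewrite exprn_ege1// cosh_ge1.
  by rewrite exprn_ge0// (le_trans ler01)// cosh_ge1.
apply: le_trans (ler_peMl (cmod_ge0 _) h1).
rewrite horner_prod cmod_prod.
have -> : n = size v by rewrite sv szl.
elim: v hv {fE sv} => [|z v IH] hv; first by rewrite big_nil expr0.
rewrite big_cons exprS; apply: ler_pM => //; rewrite ?exprn_ge0//.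
  have z1 := hv z (mem_head _ _).
  rewrite !hornerE -z1 ler_norml; apply/andP; split.
    rewrite lerNl opprB cmodC; exact: le_cmod_dist.
  exact: le_cmod_dist.
by apply: IH => y yv; apply: hv; rewrite in_cons yv orbT.
Qed.

(** The limit exponent [beta (2k-n)^2/(2n)] is rewritten with [(2k-n)^2 = n^2 - 4k(n-k)]. *)
Lemma lypoly_lim n beta k : 0 < beta -> (0 < n)%N -> (k <= n)%N ->
  'C(n, k)%:R * cosh ((k%:R *+ 2 - n%:R) * (Num.sqrt (beta / n%:R) / m.+1%:R)) ^+ (m.+1 ^ 2)%N
    @[m --> \oo] --> expR (beta * n%:R / 2) * cwcoef n beta k.
Proof.
move=> b0 n0 kn; rewrite mulrCA; apply: cvgM; first exact: cvg_cst.
rewrite -expRD.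
have := @cvg_cosh_pow R ((k%:R *+ 2 - n%:R) * Num.sqrt (beta / n%:R)).
rewrite (_ : (_ * _) ^+ 2 / 2 = beta * n%:R / 2 + - (2 * beta / n%:R * (k * (n - k))%:R)).
  move=> H; rewrite [X in X @ _ --> _](_ : _ = fun m => cosh ((k%:R *+ 2 - n%:R) *
    Num.sqrt (beta / n%:R) * m.+1%:R^-1) ^+ (m.+1 ^ 2)%N)//.
  by apply/funext => m; rewrite mulrA.
rewrite exprMn sqr_sqrtr ?divr_ge0// ?ltW// natrM natrB//.
have : n%:R != 0 :> R by rewrite pnatr_eq0 -lt0n.
by move=> h; rewrite -mulr_natr; field.
Qed.

(** At a root off the circle [lypoly_lower] would keep [lypoly] away from 0, while convergence of
    the coefficients makes its value there tend to 0. *)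
Lemma cwpoly_roots n beta : 0 < beta -> (0 < n)%N ->
  roots_on_circle (cwpoly n beta).
Proof.
move=> b0 n0 w; rewrite /root => /eqP w0; apply/eqP.
rewrite -subr_eq0 -normr_eq0; apply/negPn/negP => h.
have d0 : 0 < `|cmod w - 1| ^+ n by rewrite exprn_gt0// lt_neqAle eq_sym h/=.
have sq0 : 0 < Num.sqrt (beta / n%:R) by rewrite sqrtr_gt0 divr_gt0// ltr0n.
pose e m : R := \sum_(k < n.+1)
  `|'C(n, k)%:R * cosh ((k%:R *+ 2 - n%:R) * (Num.sqrt (beta / n%:R) / m.+1%:R)) ^+ (m.+1 ^ 2)%N
    - expR (beta * n%:R / 2) * cwcoef n beta k| * cmod w ^+ k.
have e0 : e m @[m --> \oo] --> (0 : R).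
  rewrite [X in _ --> X](_ : _ = \sum_(k < n.+1) `|0 : R| * cmod w ^+ k); last first.
    by rewrite big1// => k _; rewrite normr0 mul0r.
  apply: cvg_sumR => k _; apply: cvgMl; apply: cvg_norm.
  rewrite -[X in _ --> X](subrr (expR (beta * n%:R / 2) * cwcoef n beta k)).
  apply: cvgB; last exact: cvg_cst.
  by apply: lypoly_lim => //; rewrite -ltnS.
have := @cvgr_lt _ _ _ _ _ _ e0 _ d0.
case => m _ /(_ m (leqnn m)) /=; rewrite ltNge => /negP; apply.
apply: le_trans (@lypoly_lower n (Num.sqrt (beta / n%:R) / m.+1%:R) (m.+1 ^ 2)%N w _) _.
  by rewrite divr_gt0.
have -> : (lypoly n (Num.sqrt (beta / n%:R) / m.+1%:R) (m.+1 ^ 2)).[w] =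
  (lypoly n (Num.sqrt (beta / n%:R) / m.+1%:R) (m.+1 ^ 2)).[w]
   - (expR (beta * n%:R / 2))%:C * (cwpoly n beta).[w] by rewrite w0 mulr0 subr0.
rewrite horner_coef size_lypoly horner_poly mulr_sumr -sumrB.
apply: le_trans (le_cmod_sum _ _ _) _.
apply: ler_sum => k _.
by rewrite coef_lypoly (mulrA _ _ (w ^+ k)) -mulrBl -rcM -rcB cmodM cmodX cmod_rc.
Qed.

Lemma cwcoef_sym n beta k : (k <= n)%N -> cwcoef n beta (n - k) = cwcoef n beta k.
Proof. by move=> kn; rewrite /cwcoef bin_sub// subKn// mulnC. Qed.

Lemma cwcoef0 n beta : cwcoef n beta 0 = 1.
Proof. by rewrite /cwcoef bin0 mul0n mulr0 oppr0 expR0 mulr1. Qed.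

Lemma cwcoefn n beta : cwcoef n beta n = 1.
Proof. by rewrite -[RHS](cwcoef0 n beta) -[RHS]cwcoef_sym// subn0. Qed.

Lemma size_cwpoly n beta : size (cwpoly n beta) = n.+1.
Proof. by rewrite size_poly_eq//= cwcoefn; exact: oner_neq0. Qed.

Lemma cwpoly_factor n beta : 0 < beta -> (0 < n)%N ->
  exists u : seq C, [/\ size u = n, {in u, forall z, cmod z = 1} &
    cwpoly n beta = \prod_(z <- u) ('X + z%:P)].
Proof.
move=> b0 n0.
have f0 : cwpoly n beta != 0 by rewrite -size_poly_gt0 size_cwpoly.
have [v [fE sv hv]] := poly_factor f0.
exists [seq - z | z <- v]; split.
- by rewrite size_map sv size_cwpoly.
- by move=> _ /mapP[z zv ->]; rewrite cmodN hv//; exact: cwpoly_roots.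
- rewrite big_map [LHS]fE (_ : lead_coef _ = 1) ?scale1r.
    by apply: eq_bigr => z _; rewrite polyCN.
  rewrite lead_coefE size_cwpoly coef_poly ltnSn.
  by rewrite cwcoefn.
Qed.

Lemma cwpoly_palindromic n beta (w : C) : w != 0 ->
  (cwpoly n beta).[w] = w ^+ n * (cwpoly n beta).[w^-1].
Proof.
move=> w0; rewrite !horner_poly mulr_sumr (reindex_inj rev_ord_inj)/=.
apply: eq_bigr => k _; rewrite subSS cwcoef_sym 1?mulrCA ?(leq_ord k)//.
congr (_ * _); rewrite exprVn.
apply: (mulIf (expf_neq0 k w0)); rewrite divfK ?expf_neq0// -exprD subnK//.
by rewrite -ltnS.
Qed.

(** The coefficients are symmetric, so the product of the [w + z] may be read backwards. At [w = -t]
    its factors become the denominators [1 - z t] of the psi-transform. *)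
Lemma cwpoly_prod n beta (u : seq C) (w : C) : size u = n ->
  cwpoly n beta = \prod_(z <- u) ('X + z%:P) ->
  (cwpoly n beta).[w] = \prod_(z <- u) (1 + w * z).
Proof.
move=> su fE; have [->|w0] := eqVneq w 0.
  rewrite horner_coef0 coef_poly/= cwcoef0.
  by rewrite big1// => z _; rewrite mul0r addr0.
rewrite cwpoly_palindromic// fE horner_prod -su.
elim: (u) => [|z v IH]; first by rewrite !big_nil mulr1.
by rewrite !big_cons -IH !hornerE /= exprS; field.
Qed.

(** The relation between consecutive coefficients [c_k] is [(k+1) c_(k+1) = exp(-2 beta (n-1)/n)
    (n-k) r^k c_k]. The power [r^k] comes from [(k+1)(n-k-1) - k(n-k) = n-1-2k]. *)
Lemma cwpoly_deriv n beta (w : C) : (0 < n)%N ->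
  let r := expR (4 * beta / n%:R) in
  (cwpoly n beta)^`().[w] =
  (expR (- (2 * beta * n.-1%:R / n%:R)))%:C *
   (n%:R * (cwpoly n beta).[r%:C * w] - r%:C * w * (cwpoly n beta)^`().[r%:C * w]).
Proof.
move=> n0 r.
have D (x : C) : (cwpoly n beta)^`().[x] = \sum_(k < n) (cwcoef n beta k.+1)%:C * x ^+ k *+ k.+1.
  rewrite (@horner_coef_wide _ n); last first.
    rewrite -ltnS -(size_cwpoly n beta) lt_size_deriv//.
    by rewrite -size_poly_gt0 size_cwpoly.
  by apply: eq_bigr => k _; rewrite coef_deriv coef_poly ltnS ltn_ord mulrnAl.
have D2 (x : C) : x * (cwpoly n beta)^`().[x] = \sum_(k < n.+1) (cwcoef n beta k)%:C * x ^+ k *+ k.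
  rewrite D mulr_sumr [RHS]big_ord_recl mulr0n add0r; apply: eq_bigr => k _.
  by rewrite mulrnAr mulrCA -exprS.
have E (x : C) : n%:R * (cwpoly n beta).[x] - x * (cwpoly n beta)^`().[x] =
    \sum_(k < n) (cwcoef n beta k)%:C * x ^+ k *+ (n - k).
  rewrite D2 horner_poly mulr_sumr -sumrB big_ord_recr/= mulr_natl subrr addr0.
  by apply: eq_bigr => k _; rewrite mulr_natl mulrnBr// ltnW.
rewrite E D mulr_sumr; apply: eq_bigr => k _.
have key : cwcoef n beta k.+1 *+ k.+1 =
    expR (- (2 * beta * n.-1%:R / n%:R)) * (cwcoef n beta k * r ^+ k *+ (n - k)).
  rewrite /cwcoef /r -expRM_natl -[LHS]mulr_natl -[_ *+ (n - k)]mulr_natl.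
  rewrite mulrA -natrM mul_bin_left natrM.
  rewrite -[X in _ = _ * (_ * X)]mulrA -expRD mulrCA -!mulrA -[X in _ = _ * X]mulrCA -expRD.
  congr (_ * (_ * expR _)).
  have n0' : n%:R != 0 :> R by rewrite pnatr_eq0 -lt0n.
  rewrite -subn1 subnS !natrM -!subn1 !natrB ?subn_gt0// 1?ltnW//.
  by rewrite -(natr1 k); field.
rewrite -[LHS]mulrnAl.
transitivity ((cwcoef n beta k.+1 *+ k.+1)%:C * w ^+ k : C).
  by congr (_ * _); rewrite rcMn.
rewrite key rcM rcMn rcM (rcX r) exprMn.
move: (_%:C) (_%:C) (_ ^+ k) (_ ^+ k) => a b c d.
by rewrite !(mulrnAl, mulrnAr) !mulrA.
Qed.

End lee_yang.

(** * Zeros of the partition function and their orders *)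

Section zeros.
Variable R : realType.
Local Notation C := (Cplx R).
Local Notation I := ('i : C).
Implicit Types (Q : {poly C}) (w : C) (n : nat).

(** [spin] sends [true] to -1, so the positive spins sit where [s] is false. *)
Lemma sum_spin n (s : {ffun 'I_n -> bool}) :
  \sum_(k < n) spin R (s k) = (#|[set i | ~~ s i]%SET|%:R *+ 2 - n%:R : R)%:C.
Proof.
rewrite -sum1dep_card [in RHS]big_mkcond/= natr_sum -sumrMnl.
rewrite -[n in n%:R]card_ord -sum1_card natr_sum -sumrB rc_sum.
apply: eq_bigr => i _; rewrite /spin; case: (s i) => /=.
  by rewrite expr1 mul0rn sub0r rcN.
by rewrite expr0 mulr2n addrK.
Qed.

Lemma sum_ffun_count n (G : nat -> C) :
  \sum_(s : {ffun 'I_n -> bool}) G #|[set i | ~~ s i]%SET| =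
  \sum_(k < n.+1) 'C(n, k)%:R * G k.
Proof.
rewrite (reindex (fun A : {set 'I_n} => [ffun i => i \notin A])) /=; last first.
  exists (fun s : {ffun 'I_n -> bool} => [set i | ~~ s i]%SET) => [A|s] _.
    by apply/setP => i; rewrite inE ffunE negbK.
  by apply/ffunP => i; rewrite ffunE inE negbK.
rewrite (partition_big (fun A : {set 'I_n} => inord #|A| : 'I_n.+1) xpredT)//=.
apply: eq_bigr => k _.
rewrite -[n in 'C(n, _)]card_ord -card_draws -sum1dep_card natr_sum mulr_suml.
apply: eq_big => [A|A /eqP <-].
  rewrite -val_eqE/= inordK// ltnS; have := max_card (mem A).
  by rewrite card_ord.
rewrite mul1r inordK; last by rewrite ltnS -[X in (_ <= X)%N]card_ord max_card.
by congr (G #|pred_of_set _|); apply/setP => i; rewrite inE ffunE negbK.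
Qed.

Lemma Zcw_poly n (beta : R) (h : C) : (0 < n)%N ->
  Zcw n beta h = (expR (beta * n%:R / 2))%:C *
    (cexp (- (n%:R * h)) * (cwpoly n beta).[cexp (2 * h)]).
Proof.
move=> n0; have n0' : n%:R != 0 :> R by rewrite pnatr_eq0 -lt0n.
pose G (k : nat) : C := cexp ((beta / (2 * n%:R))%:C * (k%:R *+ 2 - n%:R : R)%:C ^+ 2
  + h * (k%:R *+ 2 - n%:R : R)%:C).
rewrite /Zcw (eq_bigr (fun s : {ffun 'I_n -> bool} => G #|[set i | ~~ s i]%SET|)); last first.
  by move=> s _; rewrite sum_spin.
rewrite sum_ffun_count horner_poly !mulr_sumr; apply: eq_bigr => k _.
rewrite -(rc_nat R 'C(n, k)) /cwcoef rcM /G -cexpMn -!cexp_rc.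
rewrite [RHS](_ : _ = ('C(n, k)%:R)%:C * (cexp (beta * n%:R / 2)%:C *
  (cexp (- (n%:R * h)) * (cexp (- (2 * beta / n%:R * (k * (n - k))%:R))%:C *
   cexp (k%:R * (2 * h))))) :> C); last by ring.
congr (_ * _); rewrite -!cexpD; congr cexp.
rewrite -rcX -rcM !addrA; rewrite [RHS](_ : _ = (beta * n%:R / 2 -
  2 * beta / n%:R * (k * (n - k))%:R)%:C + h * (k%:R *+ 2 - n%:R)); last first.
  by rewrite rcD -mulr_natr; ring.
congr (_%:C + h * _).
  rewrite natrM natrB; last by rewrite -ltnS.
  by rewrite -mulr_natr; field.
by rewrite rcB rcMn !rc_nat.
Qed.

(* [exp(-i n w) Q(exp(2 i w))] when [Q] has degree at most [n]; on such
   functions the derivative acts on [Q] as [expoly_deriv], which lowers the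
   order of a nonzero root by one. *)
Definition expoly n (Q : {poly C}) (w : C) : C :=
  \sum_(k < n.+1) Q`_k * cexp ((k%:R *+ 2 - n%:R) * I * w).

Lemma expolyE n Q w : (size Q <= n.+1)%N ->
  expoly n Q w = cexp (- (n%:R * (I * w))) * Q.[cexp (2 * (I * w))].
Proof.
move=> sQ; rewrite /expoly (horner_coef_wide _ sQ) mulr_sumr.
apply: eq_bigr => k _; rewrite mulrCA -cexpMn -cexpD; congr (_ * cexp _).
by rewrite -mulr_natr; ring.
Qed.

Lemma is_derive_cexp (c w : C) :
  is_derive w 1 (fun z : C => cexp (c * z)) (c * cexp (c * w)).
Proof.
have H : h^-1 *: (cexp (c * (h *: 1 + w)) - cexp (c * w)) @[h --> (0 : C)^'] -->
    c * cexp (c * w).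
  apply/cvgrPdist_le => /= e e0.
  pose K := 6 * cmod c ^+ 2 * cmod (cexp (c * w)) + 1.
  have K0 : 0 < K.
    by rewrite ltr_wpDl// !mulr_ge0// ?exprn_ge0 ?cmod_ge0.
  have eE : e = (Re e)%:C by apply: cplx_eq => //=; move: e0; rewrite ltcE/= => /andP[/eqP].
  have e0' : 0 < Re e by move: e0; rewrite ltcE/= => /andP[].
  (* The second bound keeps [|c h| <= 1/2], as [cexp_sub1_quad] requires; the first makes the
     quadratic error, divided by [|h|], at most [e]. *)
  pose d := Num.min (Re e / K) (1 / 2 / (cmod c + 1)).
  have c1 : 0 < cmod c + 1 by rewrite ltr_wpDl// cmod_ge0.
  have d0 : 0 < d by rewrite lt_min !divr_gt0//.
  have d0' : 0 < d%:C :> C by rewrite ltcR.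
  near=> h.
  have h0 : (h : C) != (0 : C) by near: h; exact: (@nbhs_dnbhs_neq C 0).
  have hd : cmod h < d.
    have : `|h : C| < (d%:C : C) by near: h; exact: (@dnbhs0_lt _ C _ d0').
    by rewrite norm_cmod ltcR.
  have hch : cmod (c * h) <= 1 / 2.
    rewrite cmodM; apply: (@le_trans _ _ ((cmod c + 1) * d)).
      by apply: ler_pM; rewrite ?cmod_ge0 ?lerDl// ltW.
    rewrite mulrC -ler_pdivlMr//.
    by rewrite /d ge_min lexx orbT.
  have -> : c * cexp (c * w) - h^-1 *: (cexp (c * (h *: 1 + w)) - cexp (c * w)) =
    - (h^-1 * (cexp (c * h) - 1 - c * h) * cexp (c * w)).
    rewrite mulrDr cexpD [h *: 1]mulr1 /GRing.scale/=.
    by field.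
  rewrite normrN norm_cmod eE lecR !cmodM cmodV.
  have := cexp_sub1_quad hch; set q := cmod (cexp (c * h) - 1 - c * h) => hq.
  apply: (@le_trans _ _ ((cmod h)^-1 * (6 * cmod (c * h) ^+ 2) * cmod (cexp (c * w)))).
    by rewrite ler_wpM2r ?cmod_ge0// ler_wpM2l// invr_ge0 cmod_ge0.
  have h0' : cmod h != 0 by rewrite cmod_eq0.
  rewrite cmodM exprMn.
  rewrite [leLHS](_ : _ = 6 * cmod c ^+ 2 * cmod (cexp (c * w)) * cmod h); last by field.
  apply: (@le_trans _ _ (K * cmod h)).
    by rewrite ler_wpM2r ?cmod_ge0// lerDl.
  rewrite mulrC -ler_pdivlMr//; apply: le_trans (ltW hd) _.
  by rewrite /d ge_min lexx.
apply: DeriveDef.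
  by apply/cvg_ex; exists (c * cexp (c * w)).
exact: (cvg_lim _ H).
Unshelve. all: by end_near. Qed.

Definition expoly_deriv n (Q : {poly C}) : {poly C} :=
  (2 * I) *: ('X * Q^`()) - (n%:R * I) *: Q.

Lemma coef_expoly_deriv n Q k :
  (expoly_deriv n Q)`_k = (k%:R *+ 2 - n%:R) * I * Q`_k.
Proof.
rewrite coefB !coefZ coefXM coef_deriv; case: k => [|k] /=.
  by rewrite -mulr_natr; ring.
by rewrite -[_ *+ 2]mulr_natr -[_ *+ k.+1]mulr_natr; ring.
Qed.

Lemma size_expoly_deriv n Q : (size Q <= n.+1)%N ->
  (size (expoly_deriv n Q) <= n.+1)%N.
Proof.
move=> sQ; apply/leq_sizeP => j nj; rewrite coef_expoly_deriv.
by rewrite (leq_sizeP _ _ sQ)// mulr0.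
Qed.

Lemma is_derive_expoly n Q w :
  is_derive w 1 (expoly n Q) (expoly n (expoly_deriv n Q) w).
Proof.
rewrite /expoly.
rewrite (_ : (fun w => _) = \sum_(k < n.+1) (fun w => Q`_k * cexp ((k%:R *+ 2 - n%:R) * I * w))); last first.
  by apply/funext => z; rewrite fct_sumE.
apply: is_derive_sum => k.
rewrite coef_expoly_deriv.
have D := is_derive_cexp ((k%:R *+ 2 - n%:R) * I) w.
apply: is_derive_eq.
by rewrite /GRing.scale/=; ring.
Qed.

Lemma derive1_expoly n Q : derive1 (expoly n Q) = expoly n (expoly_deriv n Q).
Proof.
apply/funext => w; rewrite derive1E.
by have [] := is_derive_expoly n Q w.
Qed.

Lemma order_expoly n m (Q G : {poly C}) (w : C) :
  (size Q <= n.+1)%N -> Q = ('X - (cexp (2 * (I * w)))%:P) ^+ m * G ->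
  G.[cexp (2 * (I * w))] != 0 -> is_order (expoly n Q) w m.
Proof.
set u := cexp _; elim: m Q G => [|m IH] Q G sQ QE Gu.
  split=> // ; rewrite /derive1n/= expolyE// -/u QE expr0 mul1r.
  by rewrite mulf_neq0// cexp_neq0.
have Q0 : expoly n Q w = 0.
  by rewrite expolyE// -/u QE exprS -mulrA hornerM hornerXsubC subrr mul0r mulr0.
(* This is the cofactor of [('X - u)^m] in [expoly_deriv n Q]. At [u] only the term from
   differentiating the power survives, and it is nonzero because [u] is an exponential. *)
pose G' := (2 * I) *: ('X * (m.+1%:R * G + ('X - u%:P) * G^`())) -
  (n%:R * I) *: (('X - u%:P) * G).
have [] := IH (expoly_deriv n Q) G' (size_expoly_deriv sQ).
- rewrite /expoly_deriv QE derivM deriv_exp/= derivB derivX derivC subr0 mul1r /G'.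
  rewrite -!mul_polyC -[_ *+ m.+1]mulr_natr exprS.
  by ring.
- have -> : G'.[u] = 2 * I * (u * (m.+1%:R * G.[u])).
    rewrite /G' -[m.+1%:R]polyC_natr.
    by rewrite !(hornerD, hornerN, hornerZ, hornerM, hornerX, hornerC); ring.
  rewrite !mulf_neq0// ?cexp_neq0// ?pnatr_eq0//.
  by apply/eqP => /(congr1 (@Im R))/=/eqP; rewrite oner_eq0.
move=> h1 h2; split.
  case=> [_|k km]; first exact: Q0.
  by rewrite derive1Sn derive1_expoly; exact: h1.
by rewrite derive1Sn derive1_expoly.
Qed.

Lemma is_order_uniq (f : C -> C) z m1 m2 : is_order f z m1 -> is_order f z m2 -> m1 = m2.
Proof.
move=> [h1 g1] [h2 g2]; case: (ltngtP m1 m2) => // h.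
  by move: g1; rewrite h2// eqxx.
by move: g2; rewrite h1// eqxx.
Qed.

Lemma is_order_multiplicity (f : C -> C) z m : is_order f z m -> multiplicity f z = m.
Proof.
move=> h; rewrite /multiplicity; case: xgetP => [k _ hk|/(_ m)//].
exact: is_order_uniq hk h.
Qed.

Lemma Zcw_expoly n (beta : R) : (0 < n)%N ->
  (fun w : C => Zcw n beta (I * w)) =
  expoly n ((expR (beta * n%:R / 2))%:C *: cwpoly n beta).
Proof.
move=> n0; apply/funext => w; rewrite Zcw_poly// expolyE.
  by rewrite hornerZ mulrCA.
by rewrite (leq_trans (size_scale_leq _ _))// size_cwpoly.
Qed.

(** The sign is there because [us] will list minus the roots of [cwpoly]: a zero [i y] of the
    partition function gives the root [exp(2 i y)], hence the entry [- exp(2 i y)]. *)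
Definition epoint (y : R) : C := - cexp (2 * I * y%:C).

Lemma mult_Zcw n (beta : R) (us : seq C) (y : R) : (0 < n)%N ->
  cwpoly n beta = \prod_(z <- us) ('X + z%:P) ->
  multiplicity (fun w : C => Zcw n beta (I * w)) y%:C = count_mem (epoint y) us.
Proof.
move=> n0 PE; rewrite Zcw_expoly//; apply: is_order_multiplicity.
pose K : C := (expR (beta * n%:R / 2))%:C.
have K0 : K != 0 by rewrite /K -cexp_rc cexp_neq0.
apply: (@order_expoly _ _ _ (K *: \prod_(z <- us | z != epoint y) ('X + z%:P))).
- by rewrite (leq_trans (size_scale_leq _ _))// size_cwpoly.
- rewrite -/K PE -scalerAr; congr (_ *: _).
  rewrite (bigID (pred1 (epoint y)))/=; congr (_ * _).
  rewrite (eq_bigr (fun=> 'X - (cexp (2 * (I * y%:C)))%:P)).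
    by rewrite big_const_seq iter_mulr_1.
  by move=> z /eqP ->; rewrite /epoint polyCN mulrA.
- rewrite hornerZ mulf_neq0// horner_prod prodf_seq_neq0.
  apply/allP => z _; apply/implyP; apply: contra; rewrite hornerD hornerX hornerC addr_eq0 => /eqP h.
  by rewrite /epoint -mulrA h opprK.
Qed.

Lemma real_zeros_Zcw n (beta : R) (us : seq C) : (0 < n)%N ->
  cwpoly n beta = \prod_(z <- us) ('X + z%:P) ->
  real_zeros (fun w : C => Zcw n beta (I * w)) = [set y | epoint y \in us].
Proof.
move=> n0 PE; apply/seteqP; split => y; rewrite /real_zeros /= Zcw_poly// PE.
  move=> /eqP; rewrite !mulf_eq0 (negbTE (cexp_neq0 _)) orFb -cexp_rc (negbTE (cexp_neq0 _)) orFb.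
  rewrite horner_prod prodf_seq_eq0 => /hasP[z zu]; rewrite andTb hornerD hornerX hornerC addr_eq0 => /eqP h.
  by rewrite /epoint -mulrA h opprK.
move=> yu; apply/eqP; rewrite !mulf_eq0 horner_prod prodf_seq_eq0.
apply/orP; right; apply/orP; right; apply/hasP; exists (epoint y) => //.
by rewrite andTb hornerD hornerX hornerC /epoint mulrA subrr.
Qed.

End zeros.

(** * The psi-transform of the zeros *)

Section fixed_point.
Variable R : realType.
Local Notation C := (Cplx R).
Implicit Types (us : seq C) (t : R) (z w x y : C) (n : nat).

Lemma poly_horner_inj (p q : {poly C}) : (forall w, p.[w] = q.[w]) -> p = q.
Proof.
move=> h; apply/eqP; rewrite -subr_eq0; apply/negPn/negP => d0.
have ar : all (root (p - q)) [seq i%:R | i <- iota 0 (size (p - q))].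
  by apply/allP => z _; rewrite /root hornerD hornerN h subrr.
have us : uniq ([seq i%:R | i <- iota 0 (size (p - q))] : seq C).
  by rewrite map_inj_uniq ?iota_uniq// => i j /eqP; rewrite eqr_nat => /eqP.
by have := max_poly_roots d0 ar us; rewrite size_map size_iota ltnn.
Qed.

(** Logarithmic derivative of the product, with the division cleared. *)
Lemma deriv_prod us w : {in us, forall z, 1 + w * z != 0} ->
  w * ((\prod_(z <- us) (1 + z *: 'X))^`()).[w] =
  (\prod_(z <- us) (1 + z *: 'X)).[w] * \sum_(z <- us) (w * z / (1 + w * z)).
Proof.
elim: us => [|z us IH] h.
  by rewrite !big_nil derivC horner0 !mulr0.
have z0 : 1 + w * z != 0 by apply: h; rewrite mem_head.
have {}IH := IH (fun y yu => h y (mem_behead (s := z :: us) yu)).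
rewrite !big_cons derivM derivD derivC derivZ derivX add0r.
rewrite !hornerD !hornerM hornerD !hornerZ hornerX !hornerC mulrDr.
rewrite [X in _ + X]mulrCA IH (mulrC z w).
by field.
Qed.

(** The psi-transform of the point mass at [u], at a real argument; [psin us] is that of the
    empirical measure of [us]. *)
Definition spsi t u : C := u * t%:C / (1 - u * t%:C).

Definition psin us t : C := (size us)%:R^-1 * \sum_(u <- us) spsi t u.

(** At [w = -t] the logarithmic derivative turns [w P'(w)] into [- n psi_n(t) P(w)]. The
    q-difference equation, multiplied by [w], then relates [psin] at [t] to [psin] at [r t]. *)
Lemma fixed_eq n (beta : R) us t : (0 < n)%N -> size us = n ->
  cwpoly n beta = \prod_(z <- us) ('X + z%:P) ->
  let r := expR (4 * beta / n%:R) in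
  {in us, forall z, 1 - z * t%:C != 0} ->
  {in us, forall z, 1 - z * (r * t)%:C != 0} ->
  psin us t = t%:C * (expR (- (2 * beta * n.-1%:R / n%:R)))%:C * (1 + psin us (r * t)) *
    \prod_(z <- us) ((1 - z * (r * t)%:C) / (1 - z * t%:C)).
Proof.
move=> n0 su PE r h1 h2.
have n0' : n%:R != 0 :> C by rewrite pnatr_eq0 -lt0n.
have QE : cwpoly n beta = \prod_(z <- us) (1 + z *: 'X).
  apply: poly_horner_inj => w; rewrite (cwpoly_prod _ su PE) horner_prod.
  by apply: eq_bigr => z _; rewrite hornerD hornerZ hornerX hornerC mulrC.
have S s : \sum_(z <- us) (- s%:C * z / (1 + - s%:C * z)) = - (n%:R * psin us s).
  rewrite /psin su mulrA mulfV// mul1r -sumrN; apply: eq_bigr => z _.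
  by rewrite /spsi !mulNr (mulrC s%:C).
have P0 : (cwpoly n beta).[- t%:C] = \prod_(z <- us) (1 - z * t%:C).
  by rewrite (cwpoly_prod _ su PE); apply: eq_bigr => z _; rewrite mulNr mulrC.
have P1 : (cwpoly n beta).[- (r * t)%:C] = \prod_(z <- us) (1 - z * (r * t)%:C).
  by rewrite (cwpoly_prod _ su PE); apply: eq_bigr => z _; rewrite mulNr mulrC.
have D s : {in us, forall z, 1 - z * s%:C != 0} ->
    - s%:C * (cwpoly n beta)^`().[- s%:C] =
    (cwpoly n beta).[- s%:C] * - (n%:R * psin us s).
  move=> h; rewrite QE deriv_prod -?S// => z zu.
  by rewrite mulNr mulrC h.
have := @cwpoly_deriv R n beta (- t%:C) n0; rewrite -/r.
move=> /(congr1 (fun x => - t%:C * x)); rewrite D//.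
rewrite (_ : r%:C * - t%:C = - (r * t)%:C); last by rewrite rcM mulrN.
rewrite D// P0 P1 prodf_div.
have p0 : \prod_(z <- us) (1 - z * t%:C) != 0.
  by rewrite prodf_seq_neq0; apply/allP => z zu; apply/implyP => _; exact: h1.
move: (\prod_(z <- us) (1 - z * t%:C)) (\prod_(z <- us) (1 - z * (r * t)%:C)) p0.
move=> a b a0 E.
apply: (mulfI n0'); apply: (mulfI a0).
rewrite mulrN in E; apply: oppr_inj; rewrite E.
by field.
Qed.

(** The factors are exchanged one at a time, and each exchange costs at most [d] times a power of
    [K]. *)
Lemma prod_dist (I : eqType) (s : seq I) (A B : I -> C) (K d : R) : 1 <= K ->
  {in s, forall i, [/\ cmod (A i) <= K, cmod (B i) <= K & cmod (A i - B i) <= d]} ->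
  cmod (\prod_(i <- s) A i - \prod_(i <- s) B i) <= (size s)%:R * K ^+ (size s) * d.
Proof.
move=> K1; have K0 : 0 <= K by apply: le_trans K1.
elim: s => [|i s IH] h; first by rewrite !big_nil subrr cmod0 mul0r mul0r.
have [hA hB hd] := h i (mem_head _ _).
have {}h := fun j js => h j (mem_behead (s := i :: s) js).
rewrite !big_cons (_ : _ - _ = A i * (\prod_(j <- s) A j - \prod_(j <- s) B j)
  + (A i - B i) * \prod_(j <- s) B j); last by ring.
have d0 : 0 <= d by apply: le_trans hd; exact: cmod_ge0.
have hP : cmod (\prod_(j <- s) B j) <= K ^+ size s.
  elim: (s) h => [|j v IHv] h; first by rewrite big_nil cmod1 expr0.
  rewrite big_cons cmodM exprS; apply: ler_pM; rewrite ?cmod_ge0//.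
    by have [] := h j (mem_head _ _).
  by apply: IHv => k kv; apply: h; rewrite in_cons kv orbT.
apply: le_trans (le_cmodD _ _) _; rewrite !cmodM.
have h1 : cmod (A i) * cmod (\prod_(j <- s) A j - \prod_(j <- s) B j) <=
    K * ((size s)%:R * K ^+ size s * d).
  by apply: ler_pM; rewrite ?cmod_ge0//; exact: IH.
have h2 : cmod (A i - B i) * cmod (\prod_(j <- s) B j) <= d * K ^+ size s.
  by apply: ler_pM; rewrite ?cmod_ge0.
have h3 : d * K ^+ size s <= K * K ^+ size s * d.
  by rewrite mulrC ler_wpM2r// ler_peMl// exprn_ge0.
rewrite /= -natr1 exprS; lra.
Qed.

Lemma sum_mean_le us (F : C -> C) (b : R) : (0 < size us)%N ->
  {in us, forall u, cmod (F u) <= b} ->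
  cmod ((size us)%:R^-1 * \sum_(u <- us) F u) <= b.
Proof.
move=> s0 h; rewrite cmodM cmodV -(rc_nat R) cmod_rc ger0_norm//.
rewrite ler_pdivrMl ?ltr0n//.
apply: le_trans (le_cmod_sum _ _ _) _.
elim: us h {s0} => [|u us IH] h; first by rewrite big_nil mul0r.
rewrite big_cons /= -nat1r mulrDl mul1r; apply: lerD; first by apply: h; rewrite mem_head.
by apply: IH => v vu; apply: h; rewrite in_cons vu orbT.
Qed.

Lemma cmod_denom t u : cmod u = 1 -> 0 <= t <= 1 / 2 -> 1 / 2 <= cmod (1 - u * t%:C).
Proof.
move=> u1 /andP[t0 t1].
have := le_cmod_dist 1 (u * t%:C); rewrite cmod1 cmodM u1 cmod_rc ger0_norm//.
lra.
Qed.

Lemma denom_neq0 t u : cmod u = 1 -> 0 <= t <= 1 / 2 -> 1 - u * t%:C != 0.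
Proof. by move=> u1 tb; rewrite -cmod_gt0; have := cmod_denom u1 tb; lra. Qed.

Lemma cmod_spsi t u : cmod u = 1 -> 0 <= t <= 1 / 2 -> cmod (spsi t u) <= 2 * t.
Proof.
move=> u1 tb; have := cmod_denom u1 tb; have /andP[t0 t1] := tb.
rewrite /spsi !cmodM cmodV u1 cmod_rc ger0_norm// mul1r => h.
rewrite ler_pdivrMr; nra.
Qed.

Lemma expR_bounds (x : R) : 0 <= x <= 1 / 2 ->
  [/\ 0 <= expR x - 1, expR x - 1 <= 2 * x & `|expR x - 1 - x| <= 2 * x ^+ 2].
Proof.
move=> /andP[x0 x1]; have h : `|expR x - 1 - x| <= 2 * x ^+ 2.
  by apply: expR_sub1_le; rewrite ger0_norm.
split=> //; first by rewrite subr_ge0; have := expR_ge1Dx x; lra.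
by move: h; rewrite ler_norml => /andP[_]; nra.
Qed.

(* The S-transform equation says that [psi(t)] is a fixed point of this map. *)
Definition Fpsi (s t : R) (x : C) : C :=
  t%:C * (expR (- (s / 2)))%:C * (1 + x) * cexp (- (s%:C * x)).

(** With [x = s/n] there are three errors: [n-1] instead of [n] in the prefactor costs [x], the
    argument [r t] instead of [t] costs [4 x], and the product instead of the exponential costs
    [8 x^2] for each of [n] factors. The accompanying terms are at most [2 e^s], [e^s] and [2 e^s],
    whence 6 and 16. *)
Lemma psin_approx n (beta : R) us t : (0 < n)%N -> 0 < beta -> size us = n ->
  cwpoly n beta = \prod_(z <- us) ('X + z%:P) ->
  {in us, forall z, cmod z = 1} -> 0 <= t <= 1 / 4 ->
  let s := 4 * beta in 2 * s <= n%:R ->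
  cmod (psin us t - Fpsi s t (psin us t)) <= expR s * (6 * s + 16 * s ^+ 2) / n%:R.
Proof.
move=> n0 b0 su PE hu tb s sn.
have s0 : 0 < s by rewrite /s; lra.
have n0' : 0 < n%:R :> R by rewrite ltr0n.
set x := s / n%:R.
have x0 : 0 < x by rewrite divr_gt0.
have x1 : x <= 1 / 2 by rewrite /x ler_pdivrMr//; lra.
have xb : 0 <= x <= 1 / 2 by rewrite ltW.
have [r1 r2 r3] := expR_bounds xb.
set r := expR x in r1 r2 r3.
have /andP[t0 t1] := tb.
have tb1 : 0 <= t <= 1 / 2 by rewrite t0/=; lra.
(* [x <= 1/2] gives [r <= 2]; this is why [t] is restricted to 1/4. *)
have tb2 : 0 <= r * t <= 1 / 2 by apply/andP; split; nra.
have sz : (0 < size us)%N by rewrite su.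
have E := @fixed_eq n beta us t n0 su PE (fun z zu => denom_neq0 (hu z zu) tb1)
  (fun z zu => denom_neq0 (hu z zu) tb2).
rewrite -/s -/x -/r in E.
set rho := expR (- (2 * beta * n.-1%:R / n%:R)) in E.
set A := \prod_(z <- us) _ in E.
set B := cexp (- (s%:C * psin us t)).
have BE : B = \prod_(z <- us) cexp (- (x%:C * spsi t z)).
  rewrite -cexp_sum sumrN -mulr_sumr; congr (cexp (- _)).
  by rewrite /psin su mulrA /x rcM rcV rc_nat.
have AE : A = \prod_(z <- us) (1 - (r - 1)%:C * spsi t z).
  rewrite /A big_seq [RHS]big_seq; apply: eq_bigr => z zu.
  have := denom_neq0 (hu z zu) tb1; rewrite /spsi rcB rc1 rcM.
  by move=> ?; field.
have sle z : z \in us -> cmod (spsi t z) <= 1.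
  by move=> zu; have := cmod_spsi (hu z zu) tb1; lra.
(* Both kinds of factors are bounded by [r], so the power [K^n] of [prod_dist] stays equal to [e^s]
   for every [n]. *)
have rn : r ^+ n = expR s.
  by rewrite /r -expRM_natl; congr expR; rewrite /x mulrC divfK// gt_eqF.
have bnd z : z \in us -> [/\ cmod (1 - (r - 1)%:C * spsi t z) <= r,
   cmod (cexp (- (x%:C * spsi t z))) <= r &
   cmod (1 - (r - 1)%:C * spsi t z - cexp (- (x%:C * spsi t z))) <= 8 * x ^+ 2].
  move=> zu; have sz1 := sle z zu.
  have cx : cmod (x%:C * spsi t z) <= x.
    by rewrite cmodM cmod_rc ger0_norm ?(ltW x0)// ler_piMr// ltW.
  split.
  - apply: le_trans (le_cmodB _ _) _; rewrite cmod1 cmodM cmod_rc ger0_norm//.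
    by have := ler_piMr r1 sz1; lra.
  - rewrite cmod_cexp /r ler_expR; apply: le_trans cx.
    by rewrite -cmodN; apply: le_trans (ler_norm _) _; exact: Re_le_cmod.
  - rewrite (_ : _ - cexp _ = - (cexp (- (x%:C * spsi t z)) - 1 - - (x%:C * spsi t z))
       - (r - 1 - x)%:C * spsi t z); last by rewrite !rcB rc1; ring.
    apply: le_trans (le_cmodB _ _) _; rewrite cmodN cmodM cmod_rc.
    have h1 : cmod (cexp (- (x%:C * spsi t z)) - 1 - - (x%:C * spsi t z)) <= 6 * x ^+ 2.
      apply: le_trans (cexp_sub1_quad _) _; rewrite cmodN; first by apply: le_trans x1.
      by rewrite ler_wpM2l// ler_pXn2r// nnegrE ?cmod_ge0// ltW.
    have h2 : `|r - 1 - x| * cmod (spsi t z) <= 2 * x ^+ 2.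
      by apply: le_trans r3; apply: ler_piMr.
    lra.
have rge1 : 1 <= r by lra.
have AB : cmod (A - B) <= n%:R * expR s * (8 * x ^+ 2).
  by rewrite AE BE -rn -su; apply: prod_dist.
have cA : cmod A <= expR s.
  rewrite AE -rn -su cmod_prod.
  elim: (us) bnd => [|z v IH] h; first by rewrite big_nil.
  rewrite big_cons exprS; apply: ler_pM; rewrite ?cmod_ge0//.
  - by rewrite prodr_ge0// => i _; exact: cmod_ge0.
  - by have [] := h z (mem_head _ _).
  - by apply: IH => y yv; apply: h; rewrite in_cons yv orbT.
have cpsi u : 0 <= u <= 1 / 2 -> cmod (psin us u) <= 1.
  move=> ub; apply: sum_mean_le => // z zu.
  by have := cmod_spsi (hu z zu) ub; lra.
have c1psi u : 0 <= u <= 1 / 2 -> cmod (1 + psin us u) <= 2.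
  by move=> ub; apply: le_trans (le_cmodD _ _) _; rewrite cmod1; have := cpsi u ub; lra.
have dpsi : cmod (psin us (r * t) - psin us t) <= 4 * x.
  rewrite /psin -mulrBr -sumrB; apply: sum_mean_le => // z zu.
  rewrite /spsi.
  have d1 := cmod_denom (hu z zu) tb1; have d2 := cmod_denom (hu z zu) tb2.
  have e1 := denom_neq0 (hu z zu) tb1; have e2 := denom_neq0 (hu z zu) tb2.
  rewrite (_ : _ - _ = z * ((r - 1) * t)%:C / ((1 - z * (r * t)%:C) * (1 - z * t%:C))); last first.
    by move: e1 e2; rewrite !rcM rcB rc1 => e1 e2; field; rewrite e1 e2.
  rewrite !cmodM cmodV cmodM (hu z zu) cmod_rc ger0_norm ?mulr_ge0// mul1r.
  rewrite ler_pdivrMr; last by rewrite mulr_gt0//; lra.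
  have : 1 / 4 <= cmod (1 - z * (r * t)%:C) * cmod (1 - z * t%:C) by nra.
  nra.
have rho0 : expR (- (s / 2)) <= 1 by rewrite expR_le1; lra.
have drho : `|rho - expR (- (s / 2))| <= x.
  rewrite /rho (_ : - (2 * beta * n.-1%:R / n%:R) = - (s / 2) + x / 2); last first.
    rewrite /x /s -subn1 natrB//; field; exact: lt0r_neq0.
  have [] := @expR_bounds (x / 2); first by lra.
  move=> f1 f2 _; rewrite expRD (_ : _ - _ = expR (- (s / 2)) * (expR (x / 2) - 1)); last by ring.
  rewrite normrM !ger0_norm ?expR_ge0//.
  have := ler_piMl f1 rho0; lra.
have es : 1 <= expR s by have := expR_ge1Dx s; lra.
rewrite {1}E /Fpsi -/B.
set p := 1 + psin us (r * t); set p' := 1 + psin us t.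
have cp : cmod p <= 2 by exact: c1psi.
have cp' : cmod p' <= 2 by exact: c1psi.
have dp : cmod (p - p') <= 4 * x.
  by rewrite (_ : p - p' = psin us (r * t) - psin us t)// /p /p'; ring.
rewrite (_ : _ - _ = t%:C * ((rho - expR (- (s / 2)))%:C * (p * A) +
   (expR (- (s / 2)))%:C * ((p - p') * A + p' * (A - B)))); last by rewrite rcB; ring.
rewrite cmodM cmod_rc ger0_norm//.
set T := cmod (_ + _).
have H1 : cmod ((rho - expR (- (s / 2)))%:C * (p * A)) <= x * (2 * expR s).
  by rewrite !cmodM cmod_rc; apply: ler_pM; rewrite ?mulr_ge0 ?cmod_ge0//; apply: ler_pM; rewrite ?cmod_ge0.
have H2 : cmod ((p - p') * A) <= 4 * x * expR s.
  by rewrite cmodM; apply: ler_pM; rewrite ?cmod_ge0.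
have H3 : cmod (p' * (A - B)) <= 2 * (n%:R * expR s * (8 * x ^+ 2)).
  by rewrite cmodM; apply: ler_pM; rewrite ?cmod_ge0.
have H4 : cmod ((p - p') * A + p' * (A - B)) <= 4 * x * expR s + 2 * (n%:R * expR s * (8 * x ^+ 2)).
  by apply: le_trans (le_cmodD _ _) _; lra.
have HT : T <= x * (2 * expR s) + (4 * x * expR s + 2 * (n%:R * expR s * (8 * x ^+ 2))).
  apply: le_trans (le_cmodD _ _) _; apply: lerD => //.
  rewrite cmodM cmod_rc ger0_norm ?expR_ge0//.
  by apply: le_trans H4; apply: ler_piMl => //; exact: cmod_ge0.
have -> : expR s * (6 * s + 16 * s ^+ 2) / n%:R =
   x * (2 * expR s) + (4 * x * expR s + 2 * (n%:R * expR s * (8 * x ^+ 2))).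
  by rewrite /x; field; exact: lt0r_neq0.
apply: le_trans HT; apply: ler_piMl; first exact: cmod_ge0.
lra.
Qed.

(** The bounds [2 t] and [4 t] are the ones available for [psin] and for [psi]. They give
    [|x - y| <= 6 t], so [12 s t <= 1] puts [s (x - y)] where [cexp_sub1_le] applies; the last
    hypothesis brings the Lipschitz constant [t e^s (1 + 8 s)] down to 1/2. *)
Lemma Fpsi_lip (s t : R) x y : 0 < s -> 0 <= t <= 1 / 4 ->
  cmod x <= 2 * t -> cmod y <= 4 * t -> 12 * s * t <= 1 ->
  2 * t * (expR s * (1 + 8 * s)) <= 1 ->
  cmod (Fpsi s t x - Fpsi s t y) <= cmod (x - y) / 2.
Proof.
move=> s0 /andP[t0 t1] hx hy st tt.
set X := cexp (- (s%:C * x)); set Y := cexp (- (s%:C * y)).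
have rho0 : expR (- (s / 2)) <= 1 by rewrite expR_le1; lra.
have cE z : cmod z <= 1 -> cmod (cexp (- (s%:C * z))) <= expR s.
  move=> z1; rewrite cmod_cexp ler_expR.
  apply: le_trans (ler_norm _) _; apply: le_trans (Re_le_cmod _) _.
  by rewrite cmodN cmodM cmod_rc gtr0_norm// ler_piMr// ltW.
have cX : cmod X <= expR s by apply: cE; lra.
have cY : cmod Y <= expR s by apply: cE; lra.
have dXY : cmod (X - Y) <= expR s * (4 * (s * cmod (x - y))).
  have -> : X - Y = Y * (cexp (- (s%:C * (x - y))) - 1).
    by rewrite mulrBr mulr1 -cexpD; congr (cexp _ - _); ring.
  rewrite cmodM; apply: ler_pM; rewrite ?cmod_ge0//.
  have cs : cmod (- (s%:C * (x - y))) = s * cmod (x - y).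
    by rewrite cmodN cmodM cmod_rc gtr0_norm.
  rewrite -cs; apply: cexp_sub1_le; rewrite cs.
  have := le_cmodB x y; nra.
rewrite /Fpsi -/X -/Y (_ : _ - _ = t%:C * ((expR (- (s / 2)))%:C *
  ((x - y) * X + (1 + y) * (X - Y)))); last by ring.
rewrite cmodM cmod_rc ger0_norm// cmodM cmod_rc ger0_norm ?expR_ge0//.
set T := cmod ((x - y) * X + (1 + y) * (X - Y)).
have cy : cmod (1 + y) <= 2 by apply: le_trans (le_cmodD _ _) _; rewrite cmod1; lra.
have d0 := cmod_ge0 (x - y).
have H1 : cmod ((x - y) * X) <= cmod (x - y) * expR s.
  by rewrite cmodM; apply: ler_pM; rewrite ?cmod_ge0.
have H2 : cmod ((1 + y) * (X - Y)) <= 2 * (expR s * (4 * (s * cmod (x - y)))).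
  by rewrite cmodM; apply: ler_pM; rewrite ?cmod_ge0.
have HT : T <= cmod (x - y) * (expR s * (1 + 8 * s)).
  by apply: le_trans (le_cmodD _ _) _; lra.
have T0 : 0 <= T by exact: cmod_ge0.
have : t * (expR (- (s / 2)) * T) <= t * T.
  by rewrite ler_wpM2l// ler_piMl.
move=> /le_trans; apply.
apply: (@le_trans _ _ (t * (cmod (x - y) * (expR s * (1 + 8 * s))))).
  by rewrite ler_wpM2l.
move: (expR s * _) tt d0 => K tt d0; nra.
Qed.

(** For a map that halves distances, the distance to the fixed point is at most twice the
    displacement, which [psin_approx] bounds. *)
Lemma psin_close n (beta : R) us t y : (0 < n)%N -> 0 < beta -> size us = n ->
  cwpoly n beta = \prod_(z <- us) ('X + z%:P) ->
  {in us, forall z, cmod z = 1} -> 0 <= t <= 1 / 4 ->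
  let s := 4 * beta in 2 * s <= n%:R -> 12 * s * t <= 1 ->
  2 * t * (expR s * (1 + 8 * s)) <= 1 ->
  cmod y <= 4 * t -> y = Fpsi s t y ->
  cmod (psin us t - y) <= 2 * (expR s * (6 * s + 16 * s ^+ 2)) / n%:R.
Proof.
move=> n0 b0 su PE hu tb s sn st tt hy yE.
have s0 : 0 < s by rewrite /s; lra.
have /andP[t0 t1] := tb.
have h1 := psin_approx n0 b0 su PE hu tb sn; rewrite -/s in h1.
have hx : cmod (psin us t) <= 2 * t.
  apply: sum_mean_le; first by rewrite su.
  by move=> z zu; apply: cmod_spsi; [exact: hu|lra].
have h2 := Fpsi_lip s0 tb hx hy st tt.
have : cmod (psin us t - y) <= cmod (psin us t - Fpsi s t (psin us t)) +
    cmod (Fpsi s t (psin us t) - Fpsi s t y).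
  apply: le_trans _ (le_cmodD _ _); rewrite -yE.
  by rewrite (_ : _ - y = psin us t - Fpsi s t (psin us t) + (Fpsi s t (psin us t) - y))//; ring.
rewrite -[2 * _ / _]mulrA.
move: (_ / n%:R) h1 => a *; lra.
Qed.

End fixed_point.

(** * Fejer approximation of pi-periodic functions *)

Section periodic.
Variable R : realType.
Local Notation C := (Cplx R).
Implicit Types (x y : R) (l : int).

Lemma sin_sq_addpi x l : sin (x + pi * l%:~R) ^+ 2 = sin x ^+ 2.
Proof.
have H (n : nat) (z : R) : sin (z + pi * n%:R) ^+ 2 = sin z ^+ 2.
  by rewrite mulr_natr (alternatingn (@sinDpi R)) exprMn sqrr_sign mul1r.
case: l => n; first exact: H.
rewrite NegzE mulrNz mulrN -[in RHS](subrK (pi * n.+1%:R) x).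
by rewrite H.
Qed.

Lemma cos_add2pi x l : cos (2 * (x + pi * l%:~R)) = cos (2 * x).
Proof.
have H (n : nat) (z : R) : cos (2 * (z + pi * n%:R)) = cos (2 * z).
  rewrite -[in RHS](periodicn (@cosD2pi R) n); congr cos.
  by rewrite -mulrnA -[pi *+ _]mulr_natr natrM; ring.
case: l => n; first exact: H.
by rewrite NegzE mulrNz mulrN -[in RHS](subrK (pi * n.+1%:R) x) H.
Qed.

Lemma sin_add2pi x l : sin (2 * (x + pi * l%:~R)) = sin (2 * x).
Proof.
have H (n : nat) (z : R) : sin (2 * (z + pi * n%:R)) = sin (2 * z).
  rewrite -[in RHS](periodicn (@sinD2pi R) n); congr sin.
  by rewrite -mulrnA -[pi *+ _]mulr_natr natrM; ring.
case: l => n; first exact: H.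
by rewrite NegzE mulrNz mulrN -[in RHS](subrK (pi * n.+1%:R) x) H.
Qed.

Lemma epointE y : epoint y = (- cos (2 * y)) +i* (- sin (2 * y)) :> C.
Proof.
have -> : epoint y = - cexp (0 +i* (2 * y) : C).
  by rewrite /epoint; congr (- cexp _); apply: cplx_eq; rewrite /=; ring.
by apply: cplx_eq; rewrite ?cReN ?cImN /= expR0 mul1r.
Qed.

Lemma epoint_addpi y l : epoint (y + pi * l%:~R) = epoint y.
Proof. by rewrite !epointE cos_add2pi sin_add2pi. Qed.

Lemma cmod_epoint y : cmod (epoint y) = 1.
Proof. by rewrite epointE /cmod/= !sqrrN cos2Dsin2 sqrtr1. Qed.

Lemma wrap x : exists l : int, - (pi / 2) < x - pi * l%:~R <= pi / 2.
Proof.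
exists (Num.ceil (x / pi - 1 / 2)).
have p0 := pi_gt0 R.
have h1 := Num.Theory.ceil_ge (x / pi - 1 / 2).
have h2 : (Num.ceil (x / pi - 1 / 2))%:~R - 1 < x / pi - 1 / 2.
  by have := Num.Theory.gt_pred_ceil (x / pi - 1 / 2); rewrite intrB.
move: (_%:~R) h1 h2 => c h1 h2.
have E : x = pi * (x / pi) by rewrite mulrC divfK// gt_eqF.
move: (x / pi) E h1 h2 => d -> h1 h2; apply/andP; split; nra.
Qed.

Definition pi_periodic (F : R -> R) := forall y l, F (y + pi * l%:~R) = F y.

Lemma periodic_unif_continuous (F : R -> R) (e : R) : continuous F -> pi_periodic F -> 0 < e ->
  exists2 d : R, 0 < d & forall x y, `|x - y| < d -> `|F x - F y| <= e.
Proof.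
move=> cF pF e0.
have K := @segment_compact R (- (pi / 2)) (pi / 2).
rewrite compact_near_coveringP in K.
have := K _ (0 : R)^'+ (fun d x => forall y, `|x - y| < d -> `|F x - F y| <= e) _.
move=> /(_ _)[].
  move=> x _; have e2 : 0 < e / 2 by rewrite divr_gt0.
  have /(@cvgrPdist_lt _ _ _ _ _ F) /(_ _ e2) := cF x.
  rewrite -nbhs_ballE => -[h /= h0 hF].
  exists (ball x (h / 2), [set d | d < h / 2]) => /=.
    split; first by apply: nbhsx_ballx; rewrite divr_gt0.
    by apply: nbhs_right_lt; rewrite divr_gt0.
  move=> [x' d] /= [xx' dh] y xy.
  rewrite /ball/= in xx' hF.
  have f1 : `|F x - F x'| < e / 2 by apply: hF => /=; rewrite /ball/=; lra.
  have f2 : `|F x - F y| < e / 2.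
    apply: hF => /=; rewrite /ball/=.
    have := ler_distD x' x y; lra.
  have := ler_distD (F x) (F x') (F y); rewrite (distrC (F x') (F x)); lra.
move=> d d0 hd.
have d2 : 0 < d / 2 by rewrite divr_gt0.
exists (d / 2) => // x y xy.
have [l lx] := wrap x.
(* Both points move by the same period. Only [x] has to land in the compact segment, because [hd]
   lets [y] range over the whole line. *)
rewrite -(pF x (- l)) -(pF y (- l)) mulrNz mulrN.
apply: (hd (d / 2)) => //=.
- by rewrite sub0r normrN gtr0_norm//; lra.
- by rewrite in_itv/=; lra.
- by rewrite (_ : _ - _ = x - y)//; ring.
Qed.

(** [|sin (x - y)|] serves as a distance modulo [pi]; it is also the quantity in terms of which
    [kernel_tail] bounds the kernel. *)
Lemma periodic_unif_sin (F : R -> R) (e : R) : continuous F -> pi_periodic F -> 0 < e ->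
  exists2 s : R, 0 < s & forall x y, `|sin (x - y)| < s -> `|F x - F y| <= e.
Proof.
move=> cF pF e0; have [d d0 hd] := periodic_unif_continuous cF pF e0.
have p0 := pi_gt0 R.
pose d' := Num.min d (pi / 2).
have d'0 : 0 < d' by rewrite lt_min d0 divr_gt0.
have d'd : d' <= d by rewrite ge_min lexx.
have d'p : d' <= pi / 2 by rewrite ge_min lexx orbT.
exists (sin d') => [|x y].
  have : sin 0 < sin d' by rewrite ltr_sin ?in_itv/=; lra.
  by rewrite sin0.
have [l /andP[l1 l2]] := wrap (x - y).
have sE : sin (x - y) ^+ 2 = sin (x - y - pi * l%:~R) ^+ 2.
  by rewrite -[in RHS](sin_sq_addpi _ l) subrK.
have {}sE : `|sin (x - y)| = `|sin (x - y - pi * l%:~R)| by rewrite -!sqrtr_sqr sE.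
rewrite sE -(pF y l) => h.
apply: hd; rewrite opprD addrA.
apply: lt_le_trans _ d'd.
move: (x - y - _) l1 l2 h => z l1 l2; rewrite !ltr_norml => /andP[h1 h2].
rewrite -sinN in h1.
rewrite !ltr_sin ?in_itv/= in h1 h2; lra.
Qed.

Lemma periodic_bounded (F : R -> R) : continuous F -> pi_periodic F ->
  exists M : R, forall y, `|F y| <= M.
Proof.
move=> cF pF; have p0 := pi_gt0 R.
have cn : {within `[- (pi / 2), pi / 2], continuous (fun y => `|F y|)}.
  by apply: continuous_subspaceT => y; apply: cvg_norm; exact: cF.
have [|c _ hc] := EVT_max _ cn; first by lra.
exists `|F c| => y; have [l /andP[l1 l2]] := wrap y.
rewrite -(pF y (- l)) mulrNz mulrN; apply: hc.
by rewrite in_itv/=; lra.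
Qed.

End periodic.

Section fejer.
Variable R : realType.
Local Notation C := (Cplx R).
Implicit Types (x y : R) (M k l m j : nat).

Definition cis x : C := cos x +i* sin x.

Lemma cisD x y : cis (x + y) = cis x * cis y.
Proof. by apply: cplx_eq; rewrite ?cReM ?cImM /= ?cosD ?sinD; ring. Qed.

Lemma cisMn x m : cis (m%:R * x) = cis x ^+ m.
Proof.
elim: m => [|m IH].
  by rewrite mul0r expr0 /cis cos0 sin0.
by rewrite -natr1 mulrDl mul1r cisD IH exprSr.
Qed.

Lemma cmod_cis x : cmod (cis x) = 1.
Proof. by rewrite /cmod/= cos2Dsin2 sqrtr1. Qed.

Lemma cmod_1Bcis x : cmod (1 - cis (2 * x)) ^+ 2 = 4 * sin x ^+ 2.
Proof.
rewrite cmod_sq !cReD !cImD !cReN !cImN /= (mulrC 2) mulr_natr cos_mulr2n sin_mulr2n.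
have := cos2Dsin2 x; move: (cos x) (sin x) => c s h.
have -> : c ^+ 2 = 1 - s ^+ 2 by rewrite -h addrK.
rewrite -mulr_natr -[(c * s) *+ 2]mulr_natr sub0r sqrrN.
rewrite (_ : (c * s * 2) ^+ 2 = 4 * (c ^+ 2) * s ^+ 2); last by ring.
have -> : c ^+ 2 = 1 - s ^+ 2 by rewrite -h addrK.
ring.
Qed.

Lemma sum_expr_1B (v : C) M : (1 - v) * \sum_(k < M) v ^+ k = 1 - v ^+ M.
Proof. by rewrite -opprB mulNr -subrX1 opprB. Qed.

(** The Fejer kernel in the variable [2 x], divided once more by [M] because it will be summed, not
    averaged, over [M] grid points. *)
Definition kernel M x : R := cmod (\sum_(k < M) cis (2 * x) ^+ k) ^+ 2 / M%:R ^+ 2.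

Lemma kernel_ge0 M x : 0 <= kernel M x.
Proof. by rewrite divr_ge0 ?sqr_ge0. Qed.

Lemma kernelE M x : kernel M x =
  (\sum_(k < M) \sum_(l < M) cos (2 * (k%:R - l%:R) * x)) / M%:R ^+ 2.
Proof.
rewrite /kernel cmod_sq Re_sum Im_sum; congr (_ / _).
rewrite !expr2 !big_distrlr -big_split/=; apply: eq_bigr => k _.
rewrite -big_split/=; apply: eq_bigr => l _.
rewrite -!cisMn/= -cosB; congr cos; ring.
Qed.

(** With [v = exp(2 i x)] the geometric sum is [(1 - v^M)/(1 - v)], where [|1 - v^M| <= 2] and
    [|1 - v| = 2 |sin x|]. *)
Lemma kernel_tail M x : (0 < M)%N -> kernel M x * sin x ^+ 2 <= (M%:R ^+ 2)^-1.
Proof.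
move=> M0; rewrite /kernel mulrAC ler_pdivrMr ?exprn_gt0 ?ltr0n//.
rewrite mulVf ?expf_neq0 ?pnatr_eq0 -?lt0n//.
have := congr1 (@cmod R) (sum_expr_1B (cis (2 * x)) M).
rewrite cmodM => h.
have h1 : cmod (1 - cis (2 * x) ^+ M) <= 2.
  by apply: le_trans (le_cmodB _ _) _; rewrite cmod1 cmodX cmod_cis expr1n.
have h2 : cmod (1 - cis (2 * x) ^+ M) ^+ 2 <= 4.
  rewrite (_ : 4 = 2 ^+ 2); last by ring.
  by rewrite ler_pXn2r ?nnegrE ?cmod_ge0.
by move: h2; rewrite -h exprMn cmod_1Bcis; lra.
Qed.

(** Up to a phase this is the real part of a full sum of powers of an [M]-th root of unity, which
    differs from 1 because [0 < m < M]. *)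
Lemma sum_cos_grid M m y : (0 < m < M)%N ->
  \sum_(j < M) cos (2 * m%:R * (y - pi * j%:R / M%:R)) = 0 :> R.
Proof.
move=> /andP[m0 mM].
have M0 : 0 < M%:R :> R by rewrite ltr0n (leq_trans _ mM).
have M0' : M%:R != 0 :> R by rewrite gt_eqF.
pose w := cis (2 * (- (pi * m%:R / M%:R))).
have wM : w ^+ M = 1.
  rewrite -cisMn [X in cis X](_ : _ = - (2 * (0 + pi * m%:R))); last by field.
  have := cos_add2pi (0 : R) (m%:Z); have := sin_add2pi (0 : R) (m%:Z).
  rewrite mulr0 cos0 sin0 => s0 c1.
  by apply: cplx_eq; rewrite /= ?cosN ?sinN -pmulrn in s0 c1 *; rewrite ?s0 ?c1 ?oppr0.
have w1 : 1 - w != 0.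
  rewrite -cmod_gt0 -(@ltr_pXn2r _ 2)// ?nnegrE ?cmod_ge0// expr0n/=.
  rewrite cmod_1Bcis mulr_gt0// exprn_even_gt0//= sinN oppr_eq0 gt_eqF//.
  rewrite sin_gt0_pi//; apply/andP; split.
    by rewrite divr_gt0// mulr_gt0 ?pi_gt0// ltr0n.
  by rewrite ltr_pdivrMr// ltr_pM2l ?pi_gt0// ltr_nat.
have S0 : \sum_(j < M) w ^+ j = 0.
  by apply: (mulfI w1); rewrite sum_expr_1B wM subrr mulr0.
transitivity (Re (cis (2 * m%:R * y) * \sum_(j < M) w ^+ j)); last by rewrite S0 mulr0.
rewrite mulr_sumr Re_sum; apply: eq_bigr => j _.
by rewrite -cisMn -cisD/=; congr cos; field.
Qed.

(** The frequencies [k - l] are below [M] in absolute value, so the grid kills all but the [M]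
    diagonal terms, each of which contributes [M]. *)
Lemma kernel_sum M y : (0 < M)%N -> \sum_(j < M) kernel M (y - pi * j%:R / M%:R) = 1.
Proof.
move=> M0; have M0' : M%:R != 0 :> R by rewrite pnatr_eq0 -lt0n.
under eq_bigr do rewrite kernelE.
rewrite -mulr_suml exchange_big/=.
rewrite (eq_bigr (fun=> M%:R)); last first.
  move=> k _; rewrite exchange_big/= (bigD1 k)//= [X in _ + X]big1 ?addr0.
    under eq_bigr do rewrite subrr mulr0 mul0r cos0.
    by rewrite sumr_const card_ord.
  move=> l lk.
  have [kl|kl|kl] := ltngtP k l; last by rewrite (val_inj kl) eqxx in lk.
  - rewrite -[RHS](@sum_cos_grid M (l - k) y) ?subn_gt0 ?kl ?(leq_ltn_trans (leq_subr _ _))//.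
    apply: eq_bigr => j _; rewrite natrB 1?ltnW// -cosN; congr cos; ring.
  - rewrite -[RHS](@sum_cos_grid M (k - l) y) ?subn_gt0 ?kl ?(leq_ltn_trans (leq_subr _ _))//.
    by apply: eq_bigr => j _; rewrite natrB 1?ltnW.
by rewrite sumr_const card_ord -[M%:R *+ M]mulr_natr -expr2 mulfV// expf_neq0.
Qed.

(* The integral of the usual convolution is replaced by the sum over [M]
   equidistant points, for which the kernel still has total mass exactly 1. *)
Definition fejer (F : R -> R) M y : R :=
  \sum_(j < M) F (pi * j%:R / M%:R) * kernel M (y - pi * j%:R / M%:R).

Lemma fejer_approx (F : R -> R) (e : R) : continuous F -> pi_periodic F -> 0 < e ->
  exists M, forall y, `|F y - fejer F M y| <= e.
Proof.
move=> cF pF e0.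
have [B hB] := periodic_bounded cF pF.
have B0 : 0 <= B by apply: le_trans (hB 0).
have e2 : 0 < e / 2 by rewrite divr_gt0.
have [s s0 hs] := periodic_unif_sin cF pF e2.
have s2 : 0 < s ^+ 2 by rewrite exprn_gt0.
(* Grid points close to [y] modulo [pi] contribute at most [e/2] together, the kernel having total
   mass 1. The others contribute at most [2 B/(s^2 M^2)] each, and this [M] brings their sum below
   [e/2]. *)
pose M := (Num.truncn (2 * (2 * B / s ^+ 2) / e)).+1.
have M0 : (0 < M)%N by [].
have M0' : 0 < M%:R :> R by rewrite ltr0n.
have hM : 2 * (2 * B / s ^+ 2) / e < M%:R by exact: Num.Theory.truncnS_gt.
exists M => y.
rewrite -[F y]mulr1 -(kernel_sum y M0) mulr_sumr /fejer -sumrB.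
apply: le_trans (ler_norm_sum _ _ _) _.
apply: (@le_trans _ _ (\sum_(j < M) (e / 2 * kernel M (y - pi * j%:R / M%:R)
   + 2 * B / s ^+ 2 / M%:R ^+ 2))).
  apply: ler_sum => j _; rewrite -mulrBl normrM (ger0_norm (kernel_ge0 _ _)).
  set x := pi * j%:R / M%:R; have k0 := kernel_ge0 M (y - x).
  have [h|h] := ltP `|sin (y - x)| s.
    apply: ler_wpDr; last by rewrite ler_wpM2r// hs.
    by rewrite !divr_ge0// ?mulr_ge0// ?sqr_ge0// ltW.
  apply: ler_wpDl; first by rewrite mulr_ge0// ltW.
  have kt : kernel M (y - x) <= (s ^+ 2)^-1 / M%:R ^+ 2.
    rewrite [leRHS]mulrC ler_pdivlMr//.
    apply: le_trans (kernel_tail (y - x) M0); rewrite ler_wpM2l//.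
    by rewrite -[leRHS]real_normK ?num_real// ler_pXn2r// nnegrE// ltW.
  rewrite -2!mulrA; apply: le_trans (_ : (B + B) * kernel M (y - x) <= _).
    rewrite ler_wpM2r//; apply: le_trans (ler_normB _ _) _; exact: lerD.
  by rewrite (_ : B + B = 2 * B) 1?mulrA ?ler_wpM2l ?mulr_ge0//; ring.
rewrite big_split/= -mulr_sumr kernel_sum// mulr1 sumr_const card_ord.
rewrite -[_ *+ M]mulr_natr -lerBrDl (_ : e - e / 2 = e / 2); last by field.
rewrite (_ : _ * M%:R = 2 * B / s ^+ 2 / M%:R); last by field; rewrite !gt_eqF.
rewrite ler_pdivrMr// -ler_pdivrMl// invf_div mulrC mulrA (mulrC _ 2).
exact: ltW.
Qed.

End fejer.

(** * Convergence of averages *)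

Section averages.
Variable R : realType.
Local Notation C := (Cplx R).
Variables (P : probability (measurableTypeR R) R) (ths : nat -> seq R).
Hypothesis size_ths : forall n, size (ths n) = n.
Implicit Types (g h F : R -> R) (G H : R -> C).

Definition cbounded g := continuous g /\ exists M : R, forall y, `|g y| <= M.

Definition avg n g : R := n%:R^-1 * \sum_(y <- ths n) g y.

Definition mean g : R := \int[P]_y g y.

Lemma cbounded_integrable g : cbounded g -> P.-integrable setT (EFin \o g).
Proof.
move=> [cg [M hM]]; apply: measurable_bounded_integrable => //.
- by rewrite (le_lt_trans (probability_le1 _ _)) ?ltry.
- exact: measurable_realfun.continuous_measurable_fun.
- exists M; split; first exact: num_real.
  by move=> x Mx y _ /=; apply: le_trans (hM y) (ltW Mx).
Qed.

Lemma cbounded_lin (a b : R) g h : cbounded g -> cbounded h ->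
  cbounded (fun y => a * g y + b * h y).
Proof.
move=> [cg [M hM]] [ch [K hK]]; split.
  move=> y; apply: cvgD; apply: cvgM; try exact: cvg_cst; [exact: cg|exact: ch].
exists (`|a| * M + `|b| * K) => y.
apply: le_trans (ler_normD _ _) _; rewrite !normrM.
by apply: lerD; rewrite ler_wpM2l.
Qed.

Lemma mean_lin (a b : R) g h : cbounded g -> cbounded h ->
  mean (fun y => a * g y + b * h y) = a * mean g + b * mean h.
Proof.
move=> cg ch; have ig := cbounded_integrable cg; have ih := cbounded_integrable ch.
rewrite /mean RintegralD//; last 2 first.
- exact: (integrableZl _ a ig).
- exact: (integrableZl _ b ih).
by rewrite !RintegralZl.
Qed.

Lemma mean_cst (c : R) : mean (fun=> c) = c.
Proof.
rewrite /mean Rintegral_cst//.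
by rewrite [X in fine X](@probability_setT _ _ _ P) mulr1.
Qed.

Lemma cbounded_cst (c : R) : cbounded (fun=> c).
Proof. by split; [move=> y; exact: cvg_cst | exists `|c|]. Qed.

Lemma mean_bound g (M : R) : cbounded g -> (forall y, `|g y| <= M) -> `|mean g| <= M.
Proof.
move=> cg hM; have ig := cbounded_integrable cg.
have ic := cbounded_integrable (cbounded_cst M).
have icn := cbounded_integrable (cbounded_cst (- M)).
rewrite ler_norml; apply/andP; split.
  rewrite -(mean_cst (- M)); apply: le_Rintegral => // y _.
  by have := hM y; rewrite ler_norml => /andP[].
rewrite -[leRHS](mean_cst M); apply: le_Rintegral => // y _.
by have := hM y; rewrite ler_norml => /andP[].
Qed.

Lemma avg_lin n (a b : R) g h : avg n (fun y => a * g y + b * h y) = a * avg n g + b * avg n h.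
Proof. by rewrite /avg big_split/= -!mulr_sumr; ring. Qed.

Lemma avg_bound n g (M : R) : 0 <= M -> (forall y, `|g y| <= M) -> `|avg n g| <= M.
Proof.
move=> M0 hM; rewrite /avg normrM.
case: (posnP n) => [->|n0]; first by rewrite invr0 normr0 mul0r.
rewrite normfV normr_nat ler_pdivrMl ?ltr0n//.
apply: le_trans (ler_norm_sum _ _ _) _.
apply: (@le_trans _ _ (\sum_(y <- ths n) M)); first exact: ler_sum.
by rewrite big_const_seq iter_addr_0 count_predT size_ths mulr_natl.
Qed.

(** [cbounded] is carried along because [mean] is linear only on integrable functions. *)
Definition avg_cvg g := cbounded g /\ (avg n g @[n --> \oo] --> mean g).

Lemma avg_cvg_lin (a b : R) g h : avg_cvg g -> avg_cvg h -> avg_cvg (fun y => a * g y + b * h y).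
Proof.
move=> [cg lg] [ch lh]; split; first exact: cbounded_lin.
rewrite mean_lin//; under eq_fun do rewrite avg_lin.
by apply: cvgD; apply: cvgM => //; exact: cvg_cst.
Qed.

Lemma avg_cvg_cst (c : R) : avg_cvg (fun=> c).
Proof.
split; first exact: cbounded_cst.
rewrite mean_cst; apply: cvg_near_cst; exists 1%N => // n /= n1.
rewrite /avg big_const_seq iter_addr_0 count_predT size_ths -[c *+ n]mulr_natl mulKf//.
by rewrite pnatr_eq0 -lt0n.
Qed.

Lemma avg_cvg_sum (I : Type) (s : seq I) (f : I -> R -> R) :
  (forall i, avg_cvg (f i)) -> avg_cvg (fun y => \sum_(i <- s) f i y).
Proof.
move=> gf; elim: s => [|i s IH].
  by under eq_fun do rewrite big_nil; exact: avg_cvg_cst.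
rewrite (_ : (fun y => _) = fun y => 1 * f i y + 1 * \sum_(i <- s) f i y).
  exact: avg_cvg_lin.
by apply/funext => y; rewrite big_cons !mul1r.
Qed.

Lemma avg_cvg_unif g : cbounded g ->
  (forall e : R, 0 < e -> exists2 h, avg_cvg h & forall y, `|g y - h y| <= e) -> avg_cvg g.
Proof.
move=> cg hg; split=> //; apply/cvgrPdist_le => /= e e0.
have e3 : 0 < e / 3 by rewrite divr_gt0.
have [h [ch lh] gh] := hg _ e3.
have E : (fun y => g y - h y) = (fun y => 1 * g y + (-1) * h y).
  by apply/funext => y; ring.
have d1 : `|mean g - mean h| <= e / 3.
  rewrite (_ : _ - _ = mean (fun y => g y - h y)).
    apply: mean_bound; last exact: gh.
    by rewrite E; exact: cbounded_lin.
  by rewrite E mean_lin//; ring.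
move/cvgrPdist_le : lh => /(_ _ e3); apply: filterS => n hn.
have d2 : `|avg n g - avg n h| <= e / 3.
  rewrite (_ : _ - _ = avg n (fun y => g y - h y)).
    by apply: avg_bound; [exact: ltW | exact: gh].
  by rewrite E avg_lin; ring.
have := ler_distD (mean h) (mean g) (avg n g).
have := ler_distD (avg n h) (mean h) (avg n g).
rewrite (distrC (avg n h)); lra.
Qed.

(** Everything complex is handled through real and imaginary parts, since [avg] and [mean] act on
    real functions. *)
Definition ccontinuous G := continuous (fun y => Re (G y)) /\ continuous (fun y => Im (G y)).

Lemma ccontinuous_cst (c : C) : ccontinuous (fun=> c).
Proof. by split=> y; exact: cvg_cst. Qed.

Lemma ccontinuousM G H : ccontinuous G -> ccontinuous H -> ccontinuous (fun y => G y * H y).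
Proof.
move=> [g1 g2] [h1 h2]; split.
  under eq_fun do rewrite cReM.
  by move=> y; apply: cvgB; apply: cvgM; [exact: g1|exact: h1|exact: g2|exact: h2].
under eq_fun do rewrite cImM.
by move=> y; apply: cvgD; apply: cvgM; [exact: g1|exact: h2|exact: g2|exact: h1].
Qed.

Lemma ccontinuousB G H : ccontinuous G -> ccontinuous H -> ccontinuous (fun y => G y - H y).
Proof.
move=> [g1 g2] [h1 h2]; split.
  under eq_fun do rewrite cReD cReN.
  by move=> y; apply: cvgB; [exact: g1|exact: h1].
under eq_fun do rewrite cImD cImN.
by move=> y; apply: cvgB; [exact: g2|exact: h2].
Qed.

Lemma ccontinuousX G k : ccontinuous G -> ccontinuous (fun y => G y ^+ k).
Proof.
move=> cG; elim: k => [|k IH]; first by under eq_fun do rewrite expr0; exact: ccontinuous_cst.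
by under eq_fun do rewrite exprS; exact: ccontinuousM.
Qed.

Lemma ccontinuousV G : (forall y, G y != 0) -> ccontinuous G -> ccontinuous (fun y => (G y)^-1).
Proof.
move=> G0 [g1 g2].
have Re_inv (z : C) : Re z^-1 = Re z / (Re z ^+ 2 + Im z ^+ 2) by case: z.
have Im_inv (z : C) : Im z^-1 = - (Im z / (Re z ^+ 2 + Im z ^+ 2)).
  by case: z => a b /=; rewrite ?mulNr.
have D0 y : Re (G y) ^+ 2 + Im (G y) ^+ 2 != 0.
  by rewrite -cmod_sq expf_neq0// cmod_eq0.
have cD y : (fun y => (Re (G y) ^+ 2 + Im (G y) ^+ 2)^-1) @ y -->
    (Re (G y) ^+ 2 + Im (G y) ^+ 2)^-1.
  by apply: cvgV => //; apply: cvgD; apply: cvgM; (exact: g1 || exact: g2).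
split.
  under eq_fun do rewrite Re_inv.
  by move=> y; apply: cvgM; [exact: g1 | exact: cD].
under eq_fun do rewrite Im_inv.
by move=> y; apply: cvgN; apply: cvgM; [exact: g2 | exact: cD].
Qed.

Lemma ccontinuous_epoint : ccontinuous (@epoint R).
Proof.
split.
  under eq_fun do rewrite epointE/=.
  move=> y; apply: cvgN; apply: continuous_comp; last exact: continuous_cos.
  by apply: cvgM; [exact: cvg_cst|exact: cvg_id].
under eq_fun do rewrite epointE/=.
move=> y; apply: cvgN; apply: continuous_comp; last exact: continuous_sin.
by apply: cvgM; [exact: cvg_cst|exact: cvg_id].
Qed.

Lemma ccbounded G (M : R) : ccontinuous G -> (forall y, cmod (G y) <= M) ->
  cbounded (fun y => Re (G y)) /\ cbounded (fun y => Im (G y)).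
Proof.
move=> [g1 g2] hM; split; split=> //; exists M => y; apply: le_trans (hM y).
  exact: Re_le_cmod.
exact: Im_le_cmod.
Qed.

Definition cavg_cvg G := avg_cvg (fun y => Re (G y)) /\ avg_cvg (fun y => Im (G y)).

Lemma cavg_cvg_cst (c : C) : cavg_cvg (fun=> c).
Proof. by split; exact: avg_cvg_cst. Qed.

Lemma cavg_cvgD G H : cavg_cvg G -> cavg_cvg H -> cavg_cvg (fun y => G y + H y).
Proof.
move=> [g1 g2] [h1 h2]; split.
  rewrite (_ : (fun y => _) = fun y => 1 * Re (G y) + 1 * Re (H y)); first exact: avg_cvg_lin.
  by apply/funext => y; rewrite cReD !mul1r.
rewrite (_ : (fun y => _) = fun y => 1 * Im (G y) + 1 * Im (H y)); first exact: avg_cvg_lin.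
by apply/funext => y; rewrite cImD !mul1r.
Qed.

Lemma cavg_cvgZ (c : C) G : cavg_cvg G -> cavg_cvg (fun y => c * G y).
Proof.
move=> [g1 g2]; split.
  rewrite (_ : (fun y => _) = fun y => Re c * Re (G y) + (- Im c) * Im (G y)); first exact: avg_cvg_lin.
  by apply/funext => y; rewrite cReM mulNr.
rewrite (_ : (fun y => _) = fun y => Re c * Im (G y) + Im c * Re (G y)); first exact: avg_cvg_lin.
by apply/funext => y; rewrite cImM.
Qed.

Lemma cavg_cvg_sum (I : Type) (s : seq I) (f : I -> R -> C) :
  (forall i, cavg_cvg (f i)) -> cavg_cvg (fun y => \sum_(i <- s) f i y).
Proof.
move=> gf; elim: s => [|i s IH].
  by under eq_fun do rewrite big_nil; exact: cavg_cvg_cst.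
by under eq_fun do rewrite big_cons; exact: cavg_cvgD.
Qed.

Lemma cavg_cvg_unif G (M : R) : ccontinuous G -> (forall y, cmod (G y) <= M) ->
  (forall e : R, 0 < e -> exists2 H, cavg_cvg H & forall y, cmod (G y - H y) <= e) -> cavg_cvg G.
Proof.
move=> cG bG hG; have [c1 c2] := ccbounded cG bG.
split; apply: avg_cvg_unif => // e e0; have [H [h1 h2] GH] := hG e e0.
  exists (fun y => Re (H y)) => // y; apply: le_trans (GH y).
  by apply: le_trans (Re_le_cmod _); rewrite cReD cReN.
exists (fun y => Im (H y)) => // y; apply: le_trans (GH y).
by apply: le_trans (Im_le_cmod _); rewrite cImD cImN.
Qed.

Variable t0 : R.
Hypothesis t0_gt0 : 0 < t0.
Hypothesis t0_le : t0 <= 1 / 2.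
Hypothesis cavg_cvg_spsi : forall t, 0 < t <= t0 -> cavg_cvg (fun y => spsi t (epoint y)).

(* [u^(k+1) / (1 - u t)] is [spsi t u] minus its Taylor polynomial, divided by
   [t^(k+1)], and tends to [u^(k+1)] uniformly as [t] tends to 0. *)
Lemma cavg_cvg_expr k : cavg_cvg (fun y => epoint y ^+ k).
Proof.
elim/ltn_ind: k => -[_|k IH].
  by under eq_fun do rewrite expr0; exact: cavg_cvg_cst.
apply: (@cavg_cvg_unif _ 1).
- by apply: ccontinuousX; exact: ccontinuous_epoint.
- by move=> y; rewrite cmodX cmod_epoint expr1n.
move=> e e0.
(* The approximation error is [|spsi t u|], at most [2 t]. *)
pose t := Num.min t0 (e / 2).
have tt0 : t <= t0 by rewrite ge_min lexx.
have te : t <= e / 2 by rewrite ge_min lexx orbT.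
have tp : 0 < t by rewrite lt_min t0_gt0 divr_gt0.
have tb : 0 <= t <= 1 / 2 by rewrite ltW//= (le_trans tt0).
have t0' : t%:C != 0 :> C by rewrite -cmod_gt0 cmod_rc normr_gt0 gt_eqF.
exists (fun y => (t%:C ^+ k.+1)^-1 * (spsi t (epoint y) +
   \sum_(m < k) (- t%:C ^+ m.+1) * epoint y ^+ m.+1)).
  apply: cavg_cvgZ; apply: cavg_cvgD; first by apply: cavg_cvg_spsi; rewrite tp.
  by apply: cavg_cvg_sum => m; apply: cavg_cvgZ; apply: IH; rewrite ltnS.
move=> y; set u := epoint y; have u1 : cmod u = 1 := cmod_epoint y.
have d0 := denom_neq0 u1 tb.
have S : \sum_(m < k) - t%:C ^+ m.+1 * u ^+ m.+1 =
    - (u * t%:C * \sum_(m < k) (u * t%:C) ^+ m).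
  rewrite mulr_sumr -sumrN; apply: eq_bigr => m _.
  by rewrite -exprS exprMn mulNr mulrC.
have E : (1 - u * t%:C) * \sum_(m < k) (u * t%:C) ^+ m = 1 - (u * t%:C) ^+ k.
  by rewrite sum_expr_1B.
have {}E : \sum_(m < k) (u * t%:C) ^+ m = (1 - (u * t%:C) ^+ k) / (1 - u * t%:C).
  by rewrite -E mulrAC mulfV// mul1r.
rewrite S E /spsi (_ : _ - _ = - (u ^+ k.+1 * (u * t%:C / (1 - u * t%:C)))).
  rewrite cmodN cmodM cmodX u1 expr1n mul1r.
  by have := cmod_spsi u1 tb; rewrite /spsi; lra.
have tk0 : t%:C ^+ k != 0 :> C by rewrite expf_neq0.
rewrite !exprS exprMn; field.
by rewrite t0' tk0 d0.
Qed.

(** As [epoint y] is [- exp(2 i y)], the cosine is the real part of a constant multiple of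
    [epoint y ^+ k]; the constant absorbs the phase and the sign [(-1)^k]. *)
Lemma avg_cvg_cos (k : nat) (a c : R) : avg_cvg (fun y => a * cos (2 * k%:R * (y - c))).
Proof.
have [g _] := cavg_cvgZ (a%:C * cis (- (2 * k%:R * c)) * (-1) ^+ k) (cavg_cvg_expr k).
rewrite (_ : (fun y => _) = fun y => Re (a%:C * cis (- (2 * k%:R * c)) * (-1) ^+ k * epoint y ^+ k))//.
apply/funext => y.
have -> : epoint y ^+ k = (-1) ^+ k * cis (k%:R * (2 * y)) :> C.
  rewrite cisMn -exprMn mulN1r; congr (_ ^+ k); rewrite epointE.
  by apply: cplx_eq.
have sgn : (-1) ^+ k * (-1) ^+ k = 1 :> C by rewrite -expr2 sqrr_sign.
transitivity (Re (a%:C * cis (- (2 * k%:R * c) + k%:R * (2 * y)) * ((-1) ^+ k * (-1) ^+ k) : C)); last first.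
  by congr (Re _); rewrite cisD; ring.
rewrite sgn mulr1.
by rewrite cReM /= mul0r subr0; congr (_ * cos _); ring.
Qed.

Lemma avg_cvg_fejer F M : avg_cvg (fejer F M).
Proof.
rewrite /fejer; apply: avg_cvg_sum => j.
rewrite (_ : (fun y => _) = fun y => \sum_(k < M) \sum_(l < M)
  (F (pi * j%:R / M%:R) / M%:R ^+ 2) * cos (2 * (k%:R - l%:R) * (y - pi * j%:R / M%:R))).
  apply: avg_cvg_sum => k; apply: avg_cvg_sum => l.
  have [kl|kl] := leqP l k.
    by have := avg_cvg_cos (k - l) (F (pi * j%:R / M%:R) / M%:R ^+ 2) (pi * j%:R / M%:R); rewrite natrB.
  have := avg_cvg_cos (l - k) (F (pi * j%:R / M%:R) / M%:R ^+ 2) (pi * j%:R / M%:R).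
  rewrite natrB ?(ltnW kl)//; congr avg_cvg; apply/funext => y.
  by rewrite -cosN; congr (_ * cos _); ring.
apply/funext => y; rewrite kernelE mulrA mulrAC mulr_sumr.
by apply: eq_bigr => k _; rewrite mulr_sumr.
Qed.

Lemma avg_cvg_periodic F : continuous F -> pi_periodic F -> avg_cvg F.
Proof.
move=> cF pF; apply: avg_cvg_unif.
  by split=> //; exact: periodic_bounded.
move=> e e0; have [M hM] := fejer_approx cF pF e0.
by exists (fejer F M) => //; exact: avg_cvg_fejer.
Qed.

End averages.

(** * Shift-invariant measures *)

Definition period_itv (R : realType) : set R := `](- (pi / 2)), (pi / 2)]%classic.
Arguments period_itv R : clear implicits.

(** * The angle map and its measurability *)

Section theta.
Variable R : realType.
Local Notation C := (Cplx R).
Implicit Types (u : C) (y : R).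

(* The inverse of [epoint] on the period interval, by the half-angle formula
   [tan y = sin(2y) / (1 + cos(2y))]. *)
Definition theta u : R :=
  if Re u == 1 then pi / 2 else atan (- Im u / (1 - Re u)).

Lemma theta_itv u : - (pi / 2) < theta u <= pi / 2.
Proof.
rewrite /theta; case: ifP => _.
  by have := pi_gt0 R; lra.
by rewrite atan_gtNpi2 ltW// atan_ltpi2.
Qed.

Lemma period_itv_theta u : period_itv R (theta u).
Proof. by rewrite /period_itv/= in_itv/= theta_itv. Qed.

Lemma cos2E y : cos (2 * y) = 2 * cos y ^+ 2 - 1.
Proof. by rewrite (mulrC 2) mulr_natr cos_mulr2n -[_ *+ 2]mulr_natr mulrC. Qed.

Lemma sin2E y : sin (2 * y) = 2 * (cos y * sin y).
Proof. by rewrite (mulrC 2) mulr_natr sin_mulr2n -[LHS]mulr_natl. Qed.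

Lemma epoint_theta u : cmod u = 1 -> epoint (theta u) = u.
Proof.
move=> u1; have := cmod_sq u; rewrite u1 expr1n epointE /theta => h.
(* On the circle [Re u = 1] forces [u = 1], which is the image of the endpoint [pi / 2], where the
   tangent is infinite. *)
case: eqP => [a1|/eqP a1].
  move: h; rewrite a1 expr1n => h.
  have b0 : Im u = 0.
    by apply/eqP; rewrite -sqrf_eq0; apply/eqP; move: h; move: (Im u ^+ 2) => b; lra.
  rewrite (_ : 2 * (pi / 2) = pi); last by field.
  by rewrite cospi sinpi; apply: cplx_eq; rewrite /= ?opprK ?oppr0.
set T := - Im u / (1 - Re u); set y := atan T.
have a0 : 1 - Re u != 0 by rewrite subr_eq0 eq_sym.
have cy : 0 < cos y by apply: cos_gt0_pihalf; rewrite atan_gtNpi2 atan_ltpi2.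
have cy0 : cos y != 0 by rewrite gt_eqF.
have tT : tan y = T by rewrite /y atanK.
have b2 : Im u ^+ 2 = (1 - Re u) * (1 + Re u).
  by rewrite (_ : (1 - Re u) * _ = 1 - Re u ^+ 2); [rewrite h; ring|ring].
have c2 : cos y ^+ 2 = (1 - Re u) / 2.
  have := cos2_tan2 cy0; rewrite tT => E.
  have {}E : (cos y ^+ 2)^-1 = 2 / (1 - Re u).
    rewrite E /T exprMn sqrrN b2; field; exact: a0.
  by rewrite -[LHS]invrK E invf_div.
have s2 : cos y * sin y = - Im u / 2.
  have -> : sin y = T * cos y by rewrite -tT /tan divfK.
  by rewrite mulrCA -expr2 c2 /T; field.
rewrite cos2E sin2E c2 s2.
by apply: cplx_eq => /=; field.
Qed.

Lemma theta_epoint y : - (pi / 2) < y <= pi / 2 -> theta (epoint y) = y.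
Proof.
move=> /andP[y1 y2]; rewrite /theta epointE /=.
have [->|y3] := eqVneq y (pi / 2).
  rewrite (_ : 2 * (pi / 2) = pi); last by field.
  by rewrite cospi opprK eqxx.
have cy : 0 < cos y by apply: cos_gt0_pihalf; rewrite y1 lt_neqAle y3.
have cy0 : cos y != 0 by rewrite gt_eqF.
rewrite cos2E sin2E ifF; last first.
  apply/negP => /eqP h; have : cos y ^+ 2 == 0.
    by apply/eqP; move: h; move: (cos y ^+ 2) => c; lra.
  by rewrite sqrf_eq0 (negbTE cy0).
have -> : - - (2 * (cos y * sin y)) / (1 - - (2 * cos y ^+ 2 - 1)) = tan y.
  rewrite opprK (_ : 1 - - (2 * cos y ^+ 2 - 1) = 2 * cos y ^+ 2); last by ring.
  by rewrite /tan; field.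
by apply: tanK; rewrite in_itv/= y1 lt_neqAle y3.
Qed.

Lemma continuous_real_part (f : C -> R) : (forall z w, `|f z - f w| <= cmod (z - w)) ->
  continuous f.
Proof.
move=> hf z; apply/(@cvgrPdist_lt _ _ _ (nbhs z)) => e e0.
apply/nbhs_ballP; exists e%:C; first by rewrite /= ltcR.
move=> w; rewrite /ball/= norm_cmod ltcR; apply: le_lt_trans; exact: hf.
Qed.

Lemma measurable_continuous (f : C -> R) : continuous f ->
  measurable_fun setT (f : BorelC R -> measurableTypeR R).
Proof.
move=> cf; apply: (measurability _ (RGenOpens.measurableE R)).
move=> _ [_ [a [b ->] <-]]; rewrite setTI; apply: sub_sigma_algebra.
by move/continuousP : cf; apply; exact: interval_open.
Qed.

Lemma measurable_Re : measurable_fun setT (@Re R : BorelC R -> measurableTypeR R).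
Proof.
apply: measurable_continuous; apply: continuous_real_part => z w.
by rewrite -cReN -cReD Re_le_cmod.
Qed.

Lemma measurable_Im : measurable_fun setT (@Im R : BorelC R -> measurableTypeR R).
Proof.
apply: measurable_continuous; apply: continuous_real_part => z w.
by rewrite -cImN -cImD Im_le_cmod.
Qed.

Lemma measurable_inv : measurable_fun setT (fun x : measurableTypeR R => x^-1 : measurableTypeR R).
Proof.
rewrite (_ : (fun x => _) = fun x : R => if x == 0 then 0 else x^-1); last first.
  by apply/funext => x; case: eqP => [->|//]; rewrite invr0.
apply: measurable_fun_if => //.
  by apply: measurable_fun_eqr.
rewrite setTI; apply: measurable_realfun.open_continuous_measurable_fun.
  rewrite (_ : _ @^-1` _ = ~` [set (0 : R)]).
    by apply: closed_openC; exact: closed_eq.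
  by apply/seteqP; split => x /=; case: eqP.
by move=> x; rewrite inE/= => /negbT x0; exact: inv_continuous.
Qed.

Lemma measurable_theta : measurable_fun setT (theta : BorelC R -> measurableTypeR R).
Proof.
apply: measurable_fun_ifT; [|exact: measurable_cst|].
  by apply: measurable_fun_eqr; [exact: measurable_Re|exact: measurable_cst].
have cat : measurable_fun setT (@atan R : measurableTypeR R -> measurableTypeR R).
  apply: measurable_realfun.continuous_measurable_fun; exact: continuous_atan.
apply: (measurableT_comp cat).
apply: measurable_funM.
  apply: measurable_continuous; apply: continuous_real_part => z w.
  by rewrite -opprD normrN -cImN -cImD Im_le_cmod.
apply: (measurableT_comp measurable_inv).
by apply: measurable_funB; [exact: measurable_cst|exact: measurable_Re].
Qed.

Definition theta_mfun : {mfun BorelC R >-> measurableTypeR R} :=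
  HB.pack (theta : BorelC R -> measurableTypeR R)
    (isMeasurableFun.Build _ _ (BorelC R) (measurableTypeR R) theta measurable_theta).

Lemma measurable_circle : measurable (@circle R : set (BorelC R)).
Proof.
have -> : @circle R = (fun u : BorelC R => Re u ^+ 2 + Im u ^+ 2) @^-1` [set (1 : R)].
  apply/seteqP; split => u /=; rewrite /circle/= norm_cmod.
    by move=> /rc_inj h; rewrite -cmod_sq h expr1n.
  by move=> h; rewrite /cmod h sqrtr1.
rewrite -[X in measurable X]setTI.
have := @measurable_funD _ _ _ _ (fun u : BorelC R => Re u ^+ 2) (fun u : BorelC R => Im u ^+ 2).
by apply => //; apply: measurable_funX; (exact: measurable_Re || exact: measurable_Im).
Qed.

End theta.
Arguments theta_mfun R : clear implicits.

Section shift_invariant.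
Variable R : realType.
Local Notation T := (measurableTypeR R).
Local Notation I := (period_itv R).
Implicit Types (mu : {measure set T -> \bar R}) (A : set T) (l : int).

Definition shift_invariant mu := forall l A, measurable A ->
  mu [set y + pi * l%:~R | y in A] = mu A.

Definition tr (l : int) (y : T) : T := y + pi * l%:~R.

Lemma measurable_tr l : measurable_fun setT (tr l).
Proof.
apply: measurable_realfun.continuous_measurable_fun => y.
by apply: cvgD; [exact: cvg_id|exact: cvg_cst].
Qed.

HB.instance Definition _ l := isMeasurableFun.Build _ _ T T (tr l) (measurable_tr l).

(** [is_nu] shifts sets by images, whereas measurability and pushforwards speak of preimages. *)
Lemma image_tr l A : [set y + pi * l%:~R | y in A] = tr (- l) @^-1` A.
Proof.
apply/seteqP; split => y /=.
  by move=> [x Ax <-]; rewrite /tr/= mulrNz mulrN addrK.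
by move=> h; exists (tr (- l) y) => //; rewrite /tr mulrNz mulrN subrK.
Qed.

Lemma shift_invariant_tr mu l A : shift_invariant mu -> measurable A ->
  mu (tr l @^-1` A) = mu A.
Proof. by move=> hmu mA; rewrite -(opprK l) -image_tr hmu. Qed.

Lemma measurable_period_itv : measurable (I : set T).
Proof. exact: measurable_itv. Qed.

Lemma measurable_tr_preimage l A : measurable A -> measurable (tr l @^-1` A).
Proof. by move=> mA; rewrite -[X in measurable X]setTI; exact: measurable_tr. Qed.

Lemma wrap_uniq (x : R) l m : I (x - pi * l%:~R) -> I (x - pi * m%:~R) -> l = m.
Proof.
rewrite /period_itv/= !in_itv/= => /andP[l1 l2] /andP[m1 m2].
have p0 := pi_gt0 R.
suff : `|l - m| < 1.
  by move=> h; apply/eqP; rewrite -subr_eq0 -normr_eq0; lia.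
rewrite -(ltr_int R) intr_norm intrB mulr1z.
move: (l%:~R) (m%:~R) l1 l2 m1 m2 => a b *.
by rewrite ltr_norml; apply/andP; split; nra.
Qed.

(** Countably many disjoint translates of the period cover the line, and invariance moves the part
    of [A] in each of them into the period itself. *)
Lemma shift_invariant_eq mu1 mu2 : shift_invariant mu1 -> shift_invariant mu2 ->
  (forall A, measurable A -> A `<=` I -> mu1 A = mu2 A) ->
  forall A, measurable A -> mu1 A = mu2 A.
Proof.
move=> h1 h2 h A mA.
(* [pickle_inv] enumerates the integers by natural numbers; a number that codes no integer gets the
   empty set. *)
pose F (n : nat) : set T := if pickle_inv n is Some l
  then A `&` tr (- l) @^-1` I else set0.
have mF n : measurable (F n).
  rewrite /F; case: pickle_inv => [l|//]; apply: measurableI => //.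
  exact: measurable_tr_preimage measurable_period_itv.
have tF : trivIset setT F.
  move=> i j _ _ [y []]; rewrite /F.
  case Ei : (pickle_inv i) => [l|//]; case Ej : (pickle_inv j) => [m|//] /=.
  rewrite /tr !mulrNz !mulrN => -[_ yl] [_ ym].
  have lm := wrap_uniq yl ym.
  have := @pickle_invK int i; have := @pickle_invK int j.
  by rewrite Ei Ej/= => <- <-; rewrite lm.
have AE : A = \bigcup_n F n.
  apply/seteqP; split => [y Ay|y [n _]]; last by rewrite /F; case: pickle_inv => [l []|].
  have [l hl] := wrap y; exists (pickle l) => //.
  rewrite /F pickleK_inv; split => //=; rewrite /tr mulrNz mulrN.
  by rewrite /period_itv/= in_itv/=.
have mU : measurable (\bigcup_n F n) by rewrite -AE.
rewrite AE !measure_semi_bigcup//; apply: eq_eseriesr => n _.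
rewrite /F; case: pickle_inv => [l|]; last by rewrite !measure0.
set B := A `&` _; have mB : measurable B.
  by apply: measurableI => //; exact: measurable_tr_preimage measurable_period_itv.
rewrite -(shift_invariant_tr l h1 mB) -(shift_invariant_tr l h2 mB); apply: h.
  exact: measurable_tr_preimage.
by move=> y [_] /=; rewrite /tr mulrNz mulrN addrK.
Qed.

End shift_invariant.

Section unfolding.
Variable R : realType.
Local Notation T := (measurableTypeR R).
Local Notation I := (period_itv R).
Implicit Types (mu : {measure set T -> \bar R}) (f : R -> R) (l : int) (K : nat).

Definition int_window K : seq int := [seq i%:Z - K%:Z | i <- iota 0 (K.*2.+1)].

Lemma uniq_int_window K : uniq (int_window K).
Proof. by rewrite map_inj_uniq ?iota_uniq// => i j /addIr []. Qed.

Lemma mem_int_window K l : `|l| <= K%:Z -> l \in int_window K.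
Proof.
move=> lK; apply/mapP; exists (absz (l + K%:Z)); last by lia.
by rewrite mem_iota; lia.
Qed.

(** Such a sum is 0 by convention when infinitely many terms are nonzero. For [f] vanishing outside
    a bounded set this does not occur. *)
Definition periodize f (y : R) : R := \sum_(l \in [set: int]) f (y + pi * l%:~R).

Lemma periodizeE f (B y : R) K : (forall x, B < `|x| -> f x = 0) ->
  (`|y| + B) / pi < K%:R ->
  periodize f y = \sum_(l <- int_window K) f (y + pi * l%:~R).
Proof.
move=> fB yK; rewrite /periodize (fsbig_seq _ _ (uniq_int_window K)).
symmetry; apply: fsbig_widen => //= l [_ /= lK]; apply: fB.
have {}lK : (K%:Z < `|l|) by rewrite ltNge; apply/negP => /mem_int_window.
have p0 := pi_gt0 R.
rewrite ltr_pdivrMr// in yK.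
have : K%:Z%:~R < (`|l|)%:~R :> R by rewrite ltr_int.
rewrite intr_norm -pmulrn.
have := ler_normB (y + pi * l%:~R) y; rewrite (_ : _ - y = pi * l%:~R); last by ring.
rewrite normrM (gtr0_norm p0); move: (`|l%:~R|) => c; nra.
Qed.

Lemma exists_nat_gt (x : R) : exists K : nat, x < K%:R.
Proof.
exists (Num.truncn x).+1; exact: Num.Theory.truncnS_gt.
Qed.

Lemma periodize_periodic f : pi_periodic (periodize f).
Proof.
move=> y m; rewrite /periodize.
rewrite [RHS](reindex_fsbigT (fun l : int => m + l)); last first.
  by exists (fun l => - m + l) => l; rewrite ?addKr ?addNKr.
by apply: eq_fsbigr => l _; rewrite intrD mulrDr addrA.
Qed.

Lemma continuous_sum_shift f (s : seq int) : continuous f ->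
  continuous (fun x : R => \sum_(l <- s) f (x + pi * l%:~R)).
Proof.
move=> cf y; elim: s => [|l s IH].
  by under eq_fun do rewrite big_nil; exact: cvg_cst.
under eq_fun do rewrite big_cons.
apply: cvgD => //; apply: (@cvg_comp _ _ _ (fun x : R => x + pi * l%:~R) f _ (nbhs (y + pi * l%:~R))).
  by apply: cvgD; [exact: cvg_id|exact: cvg_cst].
exact: cf.
Qed.

(** On the ball of radius 1 about [y] one fixed window of translates computes [periodize f], so
    locally it is a finite sum of continuous functions. *)
Lemma periodize_continuous f (B : R) : continuous f ->
  (forall x, B < `|x| -> f x = 0) -> continuous (periodize f).
Proof.
move=> cf fB y.
have [K hK] := exists_nat_gt ((`|y| + 1 + B) / pi).
have p0 := pi_gt0 R.
have near_eq : {near y, (fun x => \sum_(l <- int_window K) f (x + pi * l%:~R)) =1 periodize f}.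
  apply/nbhs_ballP; exists 1 => //= x; rewrite /ball/= => xy.
  rewrite (@periodizeE f B x K)//; apply: le_lt_trans hK.
  rewrite ler_pM2r ?invr_gt0// lerD2r.
  by have := ler_normB y (y - x); rewrite (_ : y - (y - x) = x); [lra|ring].
have e1 := nbhs_singleton near_eq; rewrite /= in e1.
rewrite /continuous_at -e1.
apply: cvg_trans (near_eq_cvg near_eq) _.
exact: continuous_sum_shift.
Qed.

(** The line is cut into translates of the period and each piece is moved back by invariance; only
    finitely many pieces meet the support. Nonnegativity allows the integrals to be added with no
    integrability condition. *)
Lemma integral_unfold mu f (B : R) : shift_invariant mu -> continuous f ->
  (forall x, 0 <= f x) -> (forall x, B < `|x| -> f x = 0) ->
  (\int[mu]_y (f y)%:E = \int[mu]_(y in I) (periodize f y)%:E)%E.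
Proof.
move=> hmu cf f0 fB.
have p0 := pi_gt0 R.
have [K hK] := exists_nat_gt ((pi / 2 + `|B|) / pi + 1).
pose S := int_window K.
pose G (l : int) (y : T) : \bar R := (((fun y => (f y)%:E) \_ (tr (- l) @^-1` I)) y)%E.
have mf : measurable_fun setT f by exact: measurable_realfun.continuous_measurable_fun.
have mfE : measurable_fun (setT : set T) (fun y => (f y)%:E) by exact/measurable_EFinP.
have mG l : measurable_fun setT (G l).
  apply/(measurable_restrictT _ _).1.
    apply: measurable_tr_preimage; exact: measurable_period_itv.
  exact: measurable_funTS.
have G0 l y : (0 <= G l y)%E by rewrite /G /patch; case: ifP => // _; rewrite lee_fin.
have fG y : ((f y)%:E = \sum_(l <- S) G l y)%E.
  have [fy|fy] := leP `|y| B; last first.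
    rewrite fB// big1// => l _; rewrite /G /patch fB//; by case: ifP.
  have [l hl] := wrap y.
  have lS : l \in S.
    apply: mem_int_window.
    have h1 : pi * `|l%:~R| <= pi / 2 + `|B| :> R.
      rewrite -{1}(gtr0_norm p0) -normrM.
      have := ler_normB y (y - pi * l%:~R); rewrite (_ : y - (y - _) = pi * l%:~R); last by ring.
      have : `|y - pi * l%:~R| <= pi / 2 by rewrite ler_norml; lra.
      have := ler_norm B; lra.
    have h2 : `|l%:~R| < K%:R :> R.
      apply: le_lt_trans hK; rewrite -lerBlDr.
      apply: le_trans (_ : `|l%:~R| <= _); first by lra.
      by rewrite ler_pdivlMr// mulrC.
    by rewrite -(ler_int R) intr_norm -pmulrn ltW.
  rewrite (bigD1_seq l)//=; last exact: uniq_int_window.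
  rewrite big1 ?adde0; last first.
    move=> m ml; rewrite /G /patch; case: ifP => // /set_mem/=.
    rewrite /tr mulrNz mulrN => hm; case/negP: ml; apply/eqP.
    by apply: (wrap_uniq hm); rewrite /period_itv/= in_itv/=.
  rewrite /G /patch mem_set//= /tr mulrNz mulrN.
  by rewrite /period_itv/= in_itv/=.
under eq_integral do rewrite fG.
rewrite ge0_integral_sum//.
have GI l : (\int[mu]_y G l y = \int[mu]_(y in I) (f (y + pi * l%:~R))%:E)%E.
  rewrite [RHS]integral_mkcond.
  (* By invariance [mu] agrees with its pushforward under [tr l], and integrating against the
     pushforward is the change of variables. *)
  rewrite (@eq_measure_integral _ T R setT (pushforward mu (tr l)) mu (G l)); last first.
    by move=> A mA _; exact: (esym (shift_invariant_tr l hmu mA)).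
  rewrite ge0_integral_pushforward//=.
  rewrite preimage_setT; apply: eq_integral => y _.
  rewrite /G /= /patch.
  have -> : (tr l y \in tr (- l) @^-1` I) = (y \in I).
    by apply/idP/idP => /set_mem h; apply/mem_set; move: h; rewrite /= /tr mulrNz mulrN addrK.
  by [].
under eq_bigr do rewrite GI.
rewrite -ge0_integral_sum//; first last.
- by move=> l y _; rewrite lee_fin.
- move=> l; apply/measurable_EFinP; apply: measurable_funTS.
  exact: (measurableT_comp mf (measurable_tr l)).
- exact: measurable_period_itv.
apply: eq_integral => y; rewrite inE /period_itv/= in_itv/= => /andP[y1 y2].
rewrite sumEFin (@periodizeE f `|B| y K)//.
  by move=> x xB; apply: fB; apply: le_lt_trans xB; exact: ler_norm.
apply: le_lt_trans hK; rewrite -lerBlDr.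
apply: le_trans (_ : (`|y| + `|B|) / pi <= _); first by lra.
by rewrite ler_pM2r ?invr_gt0// lerD2r ler_norml; lra.
Qed.

End unfolding.

Section periodization.
Local Open Scope ereal_scope.
Variables (R : realType) (P : {measure set (measurableTypeR R) -> \bar R}).

Definition periodization (A : set (measurableTypeR R)) : \bar R :=
  \esum_(l in [set: int]) P (tr l @^-1` A).

Let periodization0 : periodization set0 = 0.
Proof. by rewrite /periodization esum1// => l _; rewrite preimage_set0 measure0. Qed.

Let periodization_ge0 A : 0 <= periodization A.
Proof. by apply: esum_ge0 => l _. Qed.

Let periodization_sigma_additive : semi_sigma_additive periodization.
Proof.
move=> F mF tF mUF.
rewrite [X in _ --> X](_ : _ = \sum_(i <oo) periodization (F i)).
  by apply: is_cvg_nneseries => n _ _; exact: periodization_ge0.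
rewrite nneseries_esumT; last by move=> n; exact: periodization_ge0.
rewrite /periodization.
transitivity (\esum_(l in [set: int]) \esum_(i in [set: nat]) P (tr l @^-1` F i)).
  apply: eq_esum => l _; rewrite preimage_bigcup measure_semi_bigcup.
  - by rewrite nneseries_esumT// => i.
  - by move=> i; exact: measurable_tr_preimage.
  - by move=> i j _ _ [y [Fi Fj]]; apply: (tF i j) => //; exists (tr l y).
  - by rewrite -preimage_bigcup; exact: measurable_tr_preimage.
rewrite !esum_esum//.
rewrite (reindex_esum ([set: nat] `*`` fun=> [set: int]) _ (fun x => (x.2, x.1)))//.
split=> //=.
- by move=> [i1 i2] [j1 j2] /= _ _ [] -> ->.
- by move=> [i1 i2] _ /=; exists (i2, i1).
Qed.

HB.instance Definition _ := isMeasure.Build _ _ _ periodization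
  periodization0 periodization_ge0 periodization_sigma_additive.

Lemma periodization_invariant : shift_invariant periodization.
Proof.
move=> m A mA; rewrite image_tr /= /periodization.
rewrite [RHS](reindex_esum [set: int] _ (fun l : int => l - m)%R); last first.
  split=> //; first by move=> x y _ _ /addIr.
  by move=> l _ /=; exists (l + m)%R => //; rewrite addrK.
apply: eq_esum => l _; congr (P _); apply/seteqP; split => y /=;
  by rewrite /tr intrD mulrDr addrA.
Qed.

(** Distinct translates of the period are disjoint, so every term except [l = 0] evaluates [P] on a
    set outside the period. *)
Lemma periodization_itv A : P (~` period_itv R) = 0 -> measurable A ->
  A `<=` period_itv R -> periodization A = P A.
Proof.
move=> P0 mA AI; rewrite /periodization (esumID [set (0%R : int)])// setTI.
rewrite esum_set1// esum1 ?adde0.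
  by congr (P _); apply/seteqP; split => y /=; rewrite /tr mulr0 addr0.
move=> l /= [_ l0]; apply/eqP; rewrite eq_le measure_ge0 andbT -P0 le_measure ?inE//.
- exact: measurable_tr_preimage.
- by apply: measurableC; exact: measurable_period_itv.
move=> y /= /AI yl yI; apply: l0; apply/eqP; rewrite -oppr_eq0; apply/eqP.
apply: (@wrap_uniq _ y); first by rewrite mulrNz mulrN opprK.
by rewrite mulr0 subr0.
Qed.

End periodization.

(** * Convergence of the zero measures *)

Section zero_measure_on_period.
Variable R : realType.
Local Notation C := (Cplx R).
Local Notation T := (measurableTypeR R).
Variables (n : nat) (beta : R) (us : seq C).
Hypothesis n_gt0 : (0 < n)%N.
Hypothesis cwpolyE : cwpoly n beta = \prod_(z <- us) ('X + z%:P).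
Hypothesis us_circle : {in us, forall u, cmod u = 1}.

Local Notation Zm := (zero_measure (fun w : C => Zcw n beta ('i * w))).

Lemma zero_measureE (A : set T) : Zm A =
  \esum_(y in A `&` [set y | epoint y \in us]) (count_mem (epoint y) us)%:R%:E.
Proof.
rewrite /zero_measure (real_zeros_Zcw n_gt0 cwpolyE).
by apply: eq_esum => y _; rewrite (mult_Zcw _ n_gt0 cwpolyE).
Qed.

Lemma zero_measure_invariant : shift_invariant Zm.
Proof.
move=> l A mA; rewrite /= !zero_measureE.
rewrite (reindex_esum (A `&` [set y | epoint y \in us]) _ (fun y => y + pi * l%:~R)).
  by apply: eq_esum => y _; rewrite epoint_addpi.
split.
- by move=> y /= [Ay yu]; split; [exists y|rewrite /= epoint_addpi].
- by move=> x y _ _ /addIr.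
- move=> y [[x Ax <-]] /=; rewrite epoint_addpi => xu; exists x => //.
Qed.

(** Counting zeros with multiplicity amounts to summing over the entries of [us], and within one
    period the entry [u] comes from the single point [theta u]. *)
Lemma zero_measure_itv (A : set T) : measurable A -> A `<=` period_itv R ->
  Zm A = (\sum_(u <- us) \d_(theta u : T) A)%E.
Proof.
move=> mA AI; rewrite zero_measureE.
transitivity (\esum_(y in A `&` [set y | epoint y \in us])
   (\sum_(u <- us) ((u == epoint y)%:R : R)%:E))%E.
  apply: eq_esum => y _; rewrite sumEFin -sum1_count natr_sum big_mkcond/=.
  by congr (_%:E); apply: eq_bigr => u _; case: (u == _).
rewrite esum_sum; last by move=> y u _ _; rewrite lee_fin.
apply: eq_big_seq => u uu; rewrite diracE.
have uE : epoint (theta u) = u by apply: epoint_theta; exact: us_circle.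
have key y : A y -> (u == epoint y) -> y = theta u.
  move=> /AI + /eqP ->; rewrite /period_itv/= in_itv/= => yI.
  by rewrite theta_epoint.
have [uA|uA] := boolP ((theta u : T) \in A).
  rewrite (esumID [set (theta u : R)])//.
  rewrite (_ : A `&` _ `&` _ = [set (theta u : R)]); last first.
    apply/seteqP; split => y /=; first by case.
    by move=> ->; split => //; split; [exact: set_mem|rewrite /= uE].
  rewrite esum_set1; last by rewrite lee_fin.
  rewrite uE eqxx esum1 ?adde0// => y /= [[Ay _] yn].
  by case: eqP => // /eqP h; case: yn; exact: key.
rewrite esum1// => y /= [Ay _].
by case: eqP => // /eqP h; move: uA; rewrite -(key y Ay h) mem_set.
Qed.

Lemma integral_zero_measure (F : R -> R) : continuous F -> (forall y, 0 <= F y) ->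
  (\int[Zm]_(y in period_itv R) (F y)%:E = (\sum_(u <- us) F (theta u))%:E)%E.
Proof.
move=> cF F0.
have mF (D : set T) : measurable_fun D (fun y => (F y)%:E).
  apply/measurable_EFinP; apply: measurable_funTS.
  exact: measurable_realfun.continuous_measurable_fun.
have mI := @measurable_period_itv R.
pose m_ (j : nat) : {measure set T -> \bar R} := \d_(theta (nth 0 us j) : T).
rewrite (@eq_measure_integral _ T R (period_itv R) (msum m_ (size us))); last first.
  move=> A mA AI; apply: etrans (zero_measure_itv mA AI) _.
  by rewrite (big_nth 0) big_mkord.
rewrite ge0_integral_measure_sum//; last by move=> y _; rewrite lee_fin.
rewrite (big_nth 0) big_mkord -sumEFin; apply: eq_bigr => j _.
rewrite integral_dirac// diracE mem_set ?mul1e//.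
exact: period_itv_theta.
Qed.

End zero_measure_on_period.

(** * The limit law on the period and its psi-transform *)

Section limit_law.
Variable R : realType.
Local Notation C := (Cplx R).
Local Notation T := (measurableTypeR R).
Variable N : probability (BorelC R) R.
Hypothesis N_circle : N (@circle R) = 1%E.

Definition arg_law : probability T R := distribution N (theta_mfun R).

Lemma N_setC_circle : N (~` @circle R) = 0%E.
Proof.
have mc := @measurable_circle R.
by rewrite probability_setC// N_circle subee.
Qed.

Lemma arg_law_setC : arg_law (~` period_itv R) = 0%E.
Proof.
transitivity (N ((@theta R : BorelC R -> T) @^-1` (~` period_itv R))) => //.
rewrite (_ : _ @^-1` _ = set0) ?measure0//.
by apply/seteqP; split => u //=; apply; exact: period_itv_theta.
Qed.

(** On the circle [theta] and [epoint] are mutually inverse, so the image is the part of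
    [theta @^-1] A on the circle; what lies off the circle has no mass under [N]. *)
Lemma arg_law_image (A : set T) : measurable A -> A `<=` period_itv R ->
  arg_law A = N [set - cexp (2 * 'i * y%:C) | y in A].
Proof.
move=> mA AI; have mc := @measurable_circle R.
have mt : measurable ((@theta R : BorelC R -> T) @^-1` A).
  by rewrite -[X in measurable X]setTI; exact: measurable_theta.
rewrite [LHS](_ : _ = N ((@theta R : BorelC R -> T) @^-1` A))//.
apply: etrans (measureDI N mt mc) _.
have E0 : N ((@theta R : BorelC R -> T) @^-1` A `\` @circle R) = 0%E.
  apply/eqP; rewrite eq_le measure_ge0 andbT -N_setC_circle le_measure ?inE//.
  - exact: measurableD.
  - exact: measurableC.
transitivity (0 + N ((@theta R : BorelC R -> T) @^-1` A `&` @circle R))%E.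
  by congr (_ + _)%E; exact: E0.
rewrite add0e; congr (N _); apply/seteqP; split => u /=.
  move=> [tA]; rewrite /circle/= norm_cmod => /rc_inj u1.
  by exists (theta u) => //; exact: epoint_theta.
move=> [y Ay <-]; split.
  rewrite -/(epoint y) theta_epoint//.
  by have := AI _ Ay; rewrite /period_itv/= in_itv.
by rewrite /circle/= -/(epoint y) norm_cmod cmod_epoint.
Qed.

Lemma Rintegral_circle (g : R -> R) (h : C -> R) : cbounded g ->
  (forall u, cmod u = 1 -> h u = g (theta u)) ->
  Rintegral N (@circle R) h = mean arg_law g.
Proof.
move=> cg hg; have mc := @measurable_circle R.
have mg : measurable_fun setT (g : T -> T).
  by apply: measurable_realfun.continuous_measurable_fun; exact: cg.1.
have ig : N.-integrable setT (EFin \o (g \o (@theta R : BorelC R -> T))).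
  apply: measurable_bounded_integrable => //.
  - by rewrite (le_lt_trans (probability_le1 _ _)) ?ltry.
  - by apply: measurableT_comp => //; exact: measurable_theta.
  - have [M hM] := cg.2; exists M; split; first exact: num_real.
    by move=> x Mx u _ /=; apply: le_trans (hM _) (ltW Mx).
rewrite /mean /Rintegral; congr fine.
rewrite /arg_law integral_distribution//; last exact/measurable_EFinP.
rewrite [RHS](@negligible_integral _ _ _ N setT (~` @circle R))//.
- rewrite setTD setCK; apply: eq_integral => u; rewrite inE /circle/= norm_cmod => /rc_inj u1.
  by rewrite /= hg.
- exact: measurableC.
- exact: N_setC_circle.
Qed.

Lemma spsi_cbounded t : 0 <= t <= 1 / 2 ->
  cbounded (fun y => Re (spsi t (epoint y : C))) /\
  cbounded (fun y => Im (spsi t (epoint y : C))).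
Proof.
move=> tb; apply: (@ccbounded _ (fun y => spsi t (epoint y)) (2 * t)).
  apply: ccontinuousM.
    by apply: ccontinuousM; [exact: ccontinuous_epoint|exact: ccontinuous_cst].
  apply: ccontinuousV.
    by move=> y; apply: denom_neq0 => //; exact: cmod_epoint.
  apply: ccontinuousB; first exact: ccontinuous_cst.
  by apply: ccontinuousM; [exact: ccontinuous_epoint|exact: ccontinuous_cst].
by move=> y; apply: cmod_spsi => //; exact: cmod_epoint.
Qed.

Lemma psi_mean t : 0 <= t <= 1 / 2 ->
  psi N t%:C = mean arg_law (fun y => Re (spsi t (epoint y))) +i*
               mean arg_law (fun y => Im (spsi t (epoint y))).
Proof.
move=> tb; have [c1 c2] := spsi_cbounded tb.
rewrite /psi /cintegral; congr Complex; apply: Rintegral_circle => // u u1.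
  by rewrite epoint_theta.
by rewrite epoint_theta.
Qed.

(** Real and imaginary parts are means of functions bounded by [2 t]; adding the two bounds gives
    the constant 4. *)
Lemma cmod_psi_le t : 0 <= t <= 1 / 2 -> cmod (psi N t%:C : C) <= 4 * t.
Proof.
move=> tb; have [c1 c2] := spsi_cbounded tb.
rewrite psi_mean//; apply: le_trans (cmod_le_ReIm _) _ => /=.
have b y : cmod (spsi t (epoint y : C)) <= 2 * t.
  by apply: cmod_spsi => //; exact: cmod_epoint.
have h1 : `|mean arg_law (fun y => Re (spsi t (epoint y)))| <= 2 * t.
  by apply: mean_bound => // y; apply: le_trans (b y); exact: Re_le_cmod.
have h2 : `|mean arg_law (fun y => Im (spsi t (epoint y)))| <= 2 * t.
  by apply: mean_bound => // y; apply: le_trans (b y); exact: Im_le_cmod.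
lra.
Qed.

(** Balls of [Cplx R] have radii in that field, and a positive radius there is a real number. *)
Lemma nbhs0_cmod (Q : C -> Prop) : (\forall z \near (0 : C), Q z) ->
  exists2 d : R, 0 < d & forall z, cmod z < d -> Q z.
Proof.
move=> /nbhs_ballP[e /= e0 he].
have eE : e = (Re e)%:C by apply: cplx_eq => //=; move: e0; rewrite ltcE/= => /andP[/eqP].
exists (Re e); first by move: e0; rewrite ltcE/= => /andP[].
move=> z zd; apply: he; rewrite /ball/= sub0r normrN norm_cmod eE.
by rewrite ltcR.
Qed.

(** At [z = psi(t)] one has [chi(z) = t], so the formula for the S-transform reads
    [S(z) = (1 + z) t/z], and this is solved for [z]. *)
Lemma psi_fixed_point s : is_S_transform N (fun z => cexp (s%:C * (z + 2^-1))) ->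
  exists2 d : R, 0 < d & forall t, 0 < t < d -> t <= 1 / 2 ->
    psi N t%:C = Fpsi s t (psi N t%:C).
Proof.
move=> [_ [chi [[chi0 _ _ hchi] hS _]]].
have [d1 d1_gt0 h1] := nbhs0_cmod hchi.
have [d2 d2_gt0 h2] := @nbhs0_cmod (fun z => z != 0 ->
  cexp (s%:C * (z + 2^-1)) = (1 + z) / z * chi z) hS.
(* The factor 4 is that of [cmod_psi_le]: it brings [psi(t)] into the disc of radius [d2]. *)
exists (Num.min d1 (d2 / 4)); first by rewrite lt_min d1_gt0 divr_gt0.
move=> t /andP[t0]; rewrite lt_min => /andP[td1 td2] t1.
have tb : 0 <= t <= 1 / 2 by rewrite ltW.
have ct : cmod (t%:C : C) = t by rewrite cmod_rc gtr0_norm.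
have tC0 : t%:C != 0 :> C by rewrite -cmod_gt0 ct.
have E1 : chi (psi N t%:C) = t%:C by apply: h1; rewrite ct.
(* The S-transform formula holds only off 0; [psi(t) = 0] would give [t = chi(0) = 0]. *)
have x0 : psi N t%:C != 0 :> C.
  by apply/eqP => x0; move: E1; rewrite x0 chi0 => /esym/eqP; rewrite (negbTE tC0).
have xd : cmod (psi N t%:C : C) < d2.
  by apply: le_lt_trans (cmod_psi_le tb) _; lra.
have := h2 _ xd x0; rewrite E1.
move: (psi N t%:C : C) x0 => x x0 E.
rewrite /Fpsi -cexp_rc (_ : t%:C * cexp (- (s / 2))%:C * (1 + x) * cexp (- (s%:C * x)) =
   t%:C * (1 + x) * (cexp (s%:C * (x + 2^-1)))^-1 :> C); last first.
  rewrite -cexpN (_ : - (s%:C * (x + 2^-1)) = (- (s / 2))%:C + - (s%:C * x)); last first.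
    by rewrite rcN rcM rcV rc_nat; ring.
  by rewrite cexpD; ring.
have e0 : cexp (s%:C * (x + 2^-1)) != 0 by exact: cexp_neq0.
apply: (mulIf e0); rewrite mulfVK// E.
by field.
Qed.

End limit_law.

Lemma free_unitary_avg_cvg (R : realType) (beta : R) (N : probability (BorelC R) R)
    (us : nat -> seq (Cplx R)) :
  0 < beta -> free_unitary_normal (4 * beta) N ->
  (forall n, size (us n) = n) -> (forall n, {in us n, forall u, cmod u = 1}) ->
  (forall n, (0 < n)%N -> cwpoly n beta = \prod_(z <- us n) ('X + z%:P)) ->
  forall F, continuous F -> pi_periodic F ->
    avg_cvg (arg_law N) (fun n => map (@theta R) (us n)) F.
Proof.
move=> b0 [N1 NS] us_size us_circle usE.
set s := 4 * beta in NS.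
have s0 : 0 < s by rewrite /s; lra.
have [d d0 hd] := psi_fixed_point N1 NS.
pose E := expR s * (1 + 8 * s).
have E0 : 0 < E by rewrite mulr_gt0 ?expR_gt0//; lra.
(* The bound 1/4 is for [psin_approx], the next two for the contraction in [Fpsi_lip], and [d / 2]
   keeps [t] strictly below [d] for the fixed point equation. *)
pose t0 := Num.min (Num.min (1 / 4) (1 / (12 * s))) (Num.min (1 / (2 * E)) (d / 2)).
have t0_gt0 : 0 < t0.
  by rewrite !lt_min !divr_gt0// mulr_gt0.
have t0_le t : t <= t0 -> [/\ t <= 1 / 4, 12 * s * t <= 1, 2 * t * E <= 1 & t <= d / 2].
  rewrite !le_min => /andP[/andP[h1 h2] /andP[h3 h4]]; split => //.
    by move: h2; rewrite ler_pdivlMr ?mulr_gt0// mulrC.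
  move: h3; rewrite ler_pdivlMr 1?mulr_gt0//.
  by rewrite (_ : t * (2 * E) = 2 * t * E); last by ring.
have [t0_4 _ _ _] := t0_le t0 (lexx _).
apply: (@avg_cvg_periodic _ _ _ _ t0) => //; first by move=> n; rewrite size_map.
  by lra.
move=> t /andP[tp tt0]; have [t4 t12 tE td] := t0_le t tt0.
have tb2 : 0 <= t <= 1 / 2 by rewrite ltW//=; lra.
have tb4 : 0 <= t <= 1 / 4 by rewrite ltW.
have [c1 c2] := spsi_cbounded tb2.
have fp : psi N t%:C = Fpsi s t (psi N t%:C).
  by apply: hd; [rewrite tp/=; lra|lra].
set X : Cplx R := psi N t%:C in fp.
have XE : X = _ := psi_mean N1 tb2.
pose K := 2 * (expR s * (6 * s + 16 * s ^+ 2)).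
have K0 : 0 < K by rewrite !mulr_gt0 ?expR_gt0// addr_gt0 ?mulr_gt0// exprn_gt0.
have avgE n : psin (us n) t =
    avg (fun n => map (@theta R) (us n)) n (fun y => Re (spsi t (epoint y))) +i*
    avg (fun n => map (@theta R) (us n)) n (fun y => Im (spsi t (epoint y))).
  rewrite /psin us_size -(rc_nat R n) -rcV /avg !big_map.
  have ReZ (c : R) (z : Cplx R) : Re (c%:C * z) = c * Re z.
    by rewrite cReM /= mul0r subr0.
  have ImZ (c : R) (z : Cplx R) : Im (c%:C * z) = c * Im z.
    by rewrite cImM /= mul0r addr0.
  apply: cplx_eq; rewrite ?ReZ ?ImZ ?Re_sum ?Im_sum.
    by congr (_ * _); apply: eq_big_seq => u uu; rewrite epoint_theta// (us_circle n).
  by congr (_ * _); apply: eq_big_seq => u uu; rewrite epoint_theta// (us_circle n).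
have close (e : R) : 0 < e -> \forall n \near \oo, cmod (psin (us n) t - X) <= e.
  (* [n > K/e] brings the bound [K/n] of [psin_close] below [e], and [n > 2 s] is what that lemma
     asks for. *)
  move=> e0; exists (Num.truncn (K / e) + Num.truncn (2 * s)).+1%N => // n /= hn.
  have h1 : K / e < n%:R.
    apply: lt_le_trans (Num.Theory.truncnS_gt (K / e)) _; rewrite ler_nat.
    by apply: leq_trans hn; rewrite ltnS leq_addr.
  have h2 : 2 * s < n%:R.
    apply: lt_le_trans (Num.Theory.truncnS_gt (2 * s)) _; rewrite ler_nat.
    by apply: leq_trans hn; rewrite ltnS leq_addl.
  have n0 : (0 < n)%N by apply: leq_trans hn.
  have n0' : 0 < n%:R :> R by rewrite ltr0n.
  have := psin_close n0 b0 (us_size n) (usE n n0) (@us_circle n) tb4 (ltW h2) t12 tE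
    (cmod_psi_le N1 tb2) fp.
  move=> /le_trans; apply; rewrite -/s -/K ler_pdivrMr// mulrC -ler_pdivrMr//.
  exact: ltW.
split; split => //; apply/cvgrPdist_le => /= e e0; have := close e e0;
  apply: filterS => n; apply: le_trans; rewrite distrC avgE XE.
  by apply: le_trans _ (Re_le_cmod _); rewrite cReD cReN.
by apply: le_trans _ (Im_le_cmod _); rewrite cImD cImN.
Qed.

Section vague.
Variable R : realType.
Local Notation C := (Cplx R).
Local Notation T := (measurableTypeR R).

Lemma compact_support_bounded (f : R -> R) : compact (closure [set x | f x != 0]) ->
  exists B : R, forall x, B < `|x| -> f x = 0.
Proof.
move=> /compact_bounded [M [_ hM]]; exists (M + 1) => x hx.
apply/eqP/negPn/negP => fx.
have cx : closure [set x | f x != 0] x by exact: subset_closure.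
by have := hM (M + 1) (ltr_pwDr ltr01 (lexx M)) x cx; rewrite /= leNgt hx.
Qed.

Lemma periodize_ge0 (g : R -> R) (B : R) : (forall x, 0 <= g x) ->
  (forall x, B < `|x| -> g x = 0) -> forall y, 0 <= periodize g y.
Proof.
move=> g0 gB y; have [K hK] := exists_nat_gt ((`|y| + B) / pi).
by rewrite (periodizeE gB hK) sumr_ge0.
Qed.

Lemma integral_periodization (P : probability T R) (g : R -> R) (B : R) :
  P (~` period_itv R) = 0%E -> continuous g -> (forall x, 0 <= g x) ->
  (forall x, B < `|x| -> g x = 0) ->
  (\int[periodization P]_y (g y)%:E = (mean P (periodize g))%:E)%E.
Proof.
move=> P0 cg g0 gB.
have cF := periodize_continuous cg gB.
have F0 := periodize_ge0 g0 gB.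
have cb : cbounded (periodize g).
  by split=> //; apply: periodic_bounded => //; exact: periodize_periodic.
have iF := cbounded_integrable P cb.
have mI := @measurable_period_itv R.
rewrite (integral_unfold (periodization_invariant P) cg g0 gB).
rewrite (@eq_measure_integral _ T R (period_itv R) P); last first.
  by move=> A mA AI; exact: periodization_itv.
rewrite /mean /Rintegral fineK; last exact: integrable_fin_num.
rewrite [RHS](@negligible_integral _ _ _ P setT (~` period_itv R))//.
  by rewrite setTD setCK.
exact: measurableC.
Qed.

(** [integral_unfold] is for nonnegative functions. Written in this form, the two parts of a
    continuous function are visibly continuous. *)
Lemma pos_part_integral (mu : {measure set T -> \bar R}) (f : R -> R) :
  (\int[mu]_y (f y)%:E = \int[mu]_y ((`|f y| + f y) / 2)%:E
    - \int[mu]_y ((`|f y| - f y) / 2)%:E)%E.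
Proof.
rewrite integralE; congr (_ - _)%E; apply: eq_integral => y _.
  rewrite funeposE -EFin_max; congr (_%:E).
  by have [h|h] := leP (f y) 0; [rewrite ler0_norm//; field|rewrite gtr0_norm//; field].
rewrite funenegE -EFinN -EFin_max; congr (_%:E).
have [h|h] := leP (- f y) 0.
  by rewrite ger0_norm ?subrr ?mul0r// -oppr_le0.
by rewrite ltr0_norm -?oppr_gt0//; field.
Qed.

End vague.

(** That the limit is characterized by its values on one period is rendered as existence of a
    measure with [is_nu] together with its uniqueness on measurable sets. *)
Theorem corollary2p7 (R : realType) (beta : R) (N : probability (BorelC R) R) :
  0 < beta -> free_unitary_normal (4 * beta) N ->
  exists nu : {measure set (measurableTypeR R) -> \bar R},
    [/\ is_nu N nu,
        (forall nu' : {measure set (measurableTypeR R) -> \bar R},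
           is_nu N nu' ->
           forall A : set (measurableTypeR R), measurable A -> nu' A = nu A) &
        vague_cvg
          (fun n : nat => mscale (n%:R^-1)%:nng
             (zero_measure (fun w : Cplx R => Zcw n beta ('i * w))))
          nu].
Proof.
move=> b0 hN; have N1 := hN.1.
have P0 := arg_law_setC N.
have nuI (A : set (measurableTypeR R)) : measurable A -> A `<=` period_itv R ->
    periodization (arg_law N) A = N [set - cexp (2 * 'i * y%:C) | y in A].
  move=> mA AI; apply: etrans (periodization_itv P0 mA AI) _.
  exact: arg_law_image.
exists (periodization (arg_law N)); split.
- by split; [exact: periodization_invariant | exact: nuI].
- move=> nu' [h1 h2]; apply: shift_invariant_eq => //.
    exact: periodization_invariant.
  by move=> A mA AI; rewrite h2// -nuI.
(* For [n = 0] no factorization is asked for and the empty sequence serves; the convergence concerns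
   large [n] only. *)
have Hus n : exists us : seq (Cplx R), [/\ size us = n,
    {in us, forall u, cmod u = 1} &
    (0 < n)%N -> cwpoly n beta = \prod_(z <- us) ('X + z%:P)].
  have [n0|n0] := posnP n; first by exists [::]; rewrite n0.
  by have [u [u1 u2 u3]] := cwpoly_factor b0 n0; exists u.
have [us hus] := boolp.choice Hus.
have us_size n : size (us n) = n by have [] := hus n.
have us_circle n : {in us n, forall u, cmod u = 1} by have [] := hus n.
have usE n : (0 < n)%N -> cwpoly n beta = \prod_(z <- us n) ('X + z%:P) by have [] := hus n.
have hgood := free_unitary_avg_cvg b0 hN us_size us_circle usE.
set mu_ := fun n : nat => _.
(* Unfolded to one period, the scaled integral is exactly the average of [periodize g] over the
   angles of [us n]. *)
have main (g : R -> R) (B : R) : continuous g -> (forall x, 0 <= g x) ->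
    (forall x, B < `|x| -> g x = 0) ->
    (\int[mu_ n]_y (g y)%:E)%E @[n --> \oo] --> (mean (arg_law N) (periodize g))%:E.
  move=> cg g0 gB.
  have cF := periodize_continuous cg gB.
  have [_ h] := hgood _ cF (periodize_periodic g).
  apply: cvg_trans (_ : (avg (fun n => map (@theta R) (us n)) n (periodize g))%:E
      @[n --> \oo] --> _); last first.
    exact: cvg_comp h _.
  apply: near_eq_cvg; exists 1%N => // n /= n1.
  rewrite /mu_ ge0_integral_mscale//; first last.
  - by move=> y _; rewrite lee_fin.
  - by apply/measurable_EFinP; exact: measurable_realfun.continuous_measurable_fun.
  rewrite (integral_unfold (zero_measure_invariant n1 (usE n n1)) cg g0 gB).
  rewrite (integral_zero_measure n1 (usE n n1) (@us_circle n) cF (periodize_ge0 g0 gB)).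
  by rewrite /avg big_map -EFinM.
move=> f cf /compact_support_bounded[B fB].
have cp : continuous (fun y => (`|f y| + f y) / 2).
  move=> y; apply: cvgM; last exact: cvg_cst.
  by apply: cvgD; [apply: cvg_norm|]; exact: cf.
have cm : continuous (fun y => (`|f y| - f y) / 2).
  move=> y; apply: cvgM; last exact: cvg_cst.
  by apply: cvgB; [apply: cvg_norm|]; exact: cf.
have p0 y : 0 <= (`|f y| + f y) / 2.
  by rewrite divr_ge0//; have := ler_norm (- f y); rewrite normrN; lra.
have m0 y : 0 <= (`|f y| - f y) / 2 by rewrite divr_ge0// subr_ge0 ler_norm.
have pB y : B < `|y| -> (`|f y| + f y) / 2 = 0.
  by move=> /fB ->; rewrite normr0 addr0 mul0r.
have mB y : B < `|y| -> (`|f y| - f y) / 2 = 0.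
  by move=> /fB ->; rewrite normr0 subr0 mul0r.
rewrite pos_part_integral.
rewrite (integral_periodization P0 cp p0 pB) (integral_periodization P0 cm m0 mB).
under eq_fun do rewrite pos_part_integral.
(* Both limits are finite, so the difference of extended reals is continuous there. *)
by apply: cvgeB => //; [exact: main cp p0 pB|exact: main cm m0 mB].
Qed.
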